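(* There is an absolute constant $K>0$ such that the following holds. Let $\mu$ be a non-negative locally finite Borel measure on $\mathbb C$ with $\int_{\mathbb C}\min\left(\frac1{|\zeta|},\frac1{|\zeta|^2}\right)d\mu(\zeta)<\infty$, and suppose that its canonical integral of genus one $u(z)=\int_{\mathbb C}H(z/\zeta)\,d\mu(\zeta)$ satisfies $u(z)\ge0$ for all $z\in\mathbb C$. Then for every $r\in(0,\infty)$ $$ \mu(r)\le K\left\{ r\int_0^r\frac{\mathfrak n(t)}{t^2}\,dt+r^2\int_r^\infty\frac{\mathfrak n(t)}{t^3}\,dt\right\}. $$
   Context: Notation: $H(z)=\log|1-z|+\operatorname{Re}(z)$ for $z\in\mathbb C$ (with $H(1)=-\infty$). The integrability condition on $\mu$ forces $\mu(\{0\})=0$ (with $1/0=+\infty$), and $u$ is a subharmonic function on $\mathbb C$. $\mu(r)=\mu(\{|z|\le r\})$ is the conventional counting function. The Levin--Tsuji counting function is $\mathfrak n(r)=\mu\big(\{z:|\operatorname{Im}(1/z)|\ge 1/r\}\big)=\mu(\{|z-ir/2|\le r/2\})+\mu(\{|z+ir/2|\le r/2\})$. The right-hand side is allowed to equal $+\infty$. *)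

(* Defs.v *)
From mathcomp Require Import all_boot all_order all_algebra.
From mathcomp Require Import all_classical all_reals all_analysis.
From mathcomp Require Import complex.

Set Implicit Arguments.
Unset Strict Implicit.
Unset Printing Implicit Defensive.

Import Order.TTheory GRing.Theory Num.Theory.
Import numFieldNormedType.Exports.

Local Open Scope classical_set_scope.
Local Open Scope ring_scope.

(* The complex plane with its Borel sigma-algebra. The topology of R[i] is its
   norm topology, which the library attaches to the alias [R[i]^o]; the norm
   there takes its values in R[i], hence the use below of the R-valued modulus. *)
Definition borelC (R : realType) : measurableType _ :=
  g_sigma_algebraType (@open R[i]^o).

Definition modulus (R : realType) (z : R[i]) : R := ComplexField.Normc.normc z.

(* [lne 0 = -oo], so [Hker 1 = -oo]. *)
Definition Hker (R : realType) (z : R[i]) : \bar R :=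
  (lne (modulus (1 - z))%:E + (complex.Re z)%:E)%E.

Definition locally_finite_measure (R : realType)
    (mu : {measure set (borelC R) -> \bar R}) : Prop :=
  forall z : R[i], exists U : set R[i], [/\ @open R[i]^o U, U z & (mu U < +oo)%E].

(* The inverses are taken in [\bar R], where [0^-1 = +oo]: finiteness of the
   integral therefore forces [mu [set 0] = 0]. *)
Definition genus_one_integrable (R : realType)
    (mu : {measure set (borelC R) -> \bar R}) : Prop :=
  (\int[mu]_zeta mine ((modulus zeta)%:E^-1) (((modulus zeta) ^+ 2)%:E^-1)
     < +oo)%E.

(* The positive part of the integrand is [mu]-integrable as soon as
   [genus_one_integrable mu], so this is then a well-defined element of
   [-oo, +oo[. The convention [z / 0 = 0] is harmless, the origin being
   [mu]-null. *)
Definition canonical_integral (R : realType)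
    (mu : {measure set (borelC R) -> \bar R}) (z : R[i]) : \bar R :=
  (\int[mu]_zeta Hker (z / (zeta : R[i]))%R)%E.

Definition counting_function (R : realType)
    (mu : {measure set (borelC R) -> \bar R}) (r : R) : \bar R :=
  mu [set z : R[i] | modulus z <= r].

(* Away from the origin the set below is the union of the two closed discs of
   radius [r / 2] centred at [i r / 2] and [- i r / 2]. Those discs meet only at
   the origin, which the convention [0^-1 = 0] excludes from the set but which
   is [mu]-null under [genus_one_integrable mu]. *)
Definition levin_tsuji (R : realType)
    (mu : {measure set (borelC R) -> \bar R}) (r : R) : \bar R :=
  mu [set z : R[i] | r^-1 <= `|complex.Im (z^-1)|].

(* Main.v *)
From HB Require Import structures.
Require Import Defs.
From mathcomp Require Import all_boot all_order all_algebra.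
From mathcomp Require Import all_classical all_reals all_analysis.
From mathcomp Require Import measurable_realfun complex.
From mathcomp Require Import ring lra.

Set Implicit Arguments.
Unset Strict Implicit.
Unset Printing Implicit Defensive.

Import Order.TTheory GRing.Theory Num.Theory.
Import numFieldNormedType.Exports.

Local Open Scope classical_set_scope.
Local Open Scope ring_scope.

(* Write w = 1/zeta. For real x, the values of u at x and -x add up to the
   mu-integral of log|1 - x^2 w^2|. Averaging this over x = r/t against dt on
   [1, +oo[ gives a function of r w = a + ib which is nonpositive for b = 0,
   bounded away from 0 there as soon as |a| >= 1/2, and whose positive part is
   O(min(|b|, b^2)). Since u >= 0, the mu-mass of |r w| >= 1, which is the mass
   of |zeta| <= r, is therefore controlled by the mu-integral of
   min(|r Im w|, (r Im w)^2), and the latter is comparable to the right-hand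
   side by the layer cake formula. *)

(** * Logarithmic integrals *)

(** For w = a + ib with b > 0 the average is explicit: the integral of log|1 - w^2/t^2| over [1,
    +oo[ is pi b - Phi(a, b), where Phi(a, b) is [log_maj_prim a b 1] and pi b is the limit of its
    arctangents at infinity. As b tends to 0, Phi tends to (1 + a) log(1 + a) + (1 - a) log|1 - a|,
    which is nonnegative, and at least 1/5 for a >= 1/2; sign and gap on the real axis both come
    from this function. Two obstacles shape the proof. The kernel is singular on the real axis, so
    its average is never computed there: its modulus increases with |b|, hence |b| may be raised to
    a height c > 0, at a cost of pi c. That cost is linear in c, so near the origin, where O(b^2) is
    required, a pointwise bound takes over. Moreover the kernel is a priori integrable only from
    above; the positivity of u itself supplies the missing half. *)

Section log_potential.
Context {R : realType}.
Implicit Types a b t x y : R.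

Lemma ln_le_subr1 x : 0 < x -> ln x <= x - 1.
Proof. by move=> x0; have := @le_ln1Dx R (x - 1); rewrite subrKC; apply; lra. Qed.

Lemma onem_inv_le_ln x : 0 < x -> 1 - x^-1 <= ln x.
Proof.
move=> x0; have := @ln_le_subr1 x^-1; rewrite invr_gt0 lnV ?posrE// => /(_ x0).
lra.
Qed.

(** Primitive of log|y + ib|, found by parts. The arctangent is what leaves [pi * b] at infinity. *)
Definition half_prim b y :=
  y * ln (y ^+ 2 + b ^+ 2) / 2 + b * atan (y / b) - y.

Lemma is_derive_half_prim b y : 0 < b ->
  is_derive y 1 (half_prim b) (ln (y ^+ 2 + b ^+ 2) / 2).
Proof.
move=> b0.
have p : 0 < y ^+ 2 + b ^+ 2 by rewrite ltr_wpDl ?sqr_ge0// exprn_gt0.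
have d1 : is_derive y 1 (fun y => ln (y ^+ 2 + b ^+ 2))
   ((y ^+ 2 + b ^+ 2)^-1 * (2 * y)).
  have h := @is_derive1_ln R _ p.
  have k : is_derive y 1 (fun y : R => y ^+ 2 + b ^+ 2) (2 * y).
    by apply: is_derive_eq; rewrite ?scaler0 ?addr0 /GRing.scale/=; ring.
  by have := @is_derive1_comp R (@ln R) (fun y : R => y ^+ 2 + b ^+ 2) y _ _ h k.
have d2 : is_derive y 1 (fun y => atan (y / b)) (b / (y ^+ 2 + b ^+ 2)).
  have k : is_derive y 1 (fun y : R => y / b) b^-1.
    apply: is_derive_eq; rewrite ?scaler0 ?add0r ?addr0 /GRing.scale/=; ring.
  have h := @is_derive1_comp R (@atan R) (fun y : R => y / b) y _ _
    (is_derive1_atan _) k.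
  apply: (is_derive_eq h).
  field.
  by rewrite !lt0r_neq0.
rewrite /half_prim.
apply: is_derive_eq.
rewrite !scaler0 ?addr0 ?add0r /GRing.scale/=.
field; exact: lt0r_neq0.
Qed.

Lemma is_derive_integral (f F : R -> R) a b : a < b ->
  (forall x, a <= x <= b -> is_derive x 1 F (f x)) ->
  (forall x, a <= x <= b -> derivable f x 1) ->
  (\int[lebesgue_measure]_(x in `[a, b]) (f x)%:E = (F b - F a)%:E)%E.
Proof.
move=> ab dF df.
rewrite (@continuous_FTC2 _ f F)//.
- by apply: derivable_within_continuous => x; rewrite in_itv/= => /df.
- have cF : {within `[a, b], continuous F}.
    by apply: derivable_within_continuous => x; rewrite in_itv/= => /dF[].
  have [_ cFa cFb] := (continuous_within_itvP F ab).1 cF.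
  split => // x; rewrite in_itv/= => /andP[ax xb].
  by have [] // := dF x _; rewrite !ltW.
- move=> x; rewrite in_itv/= => /andP[ax xb].
  have h : is_derive x 1 F (f x) by apply: dF; rewrite !ltW.
  by rewrite derive1E derive_val.
Qed.

(* For [t > 0] this is [log |1 - (a + i b)^2 / t^2|]. *)
Definition log_maj a b t :=
  (ln ((t - a) ^+ 2 + b ^+ 2) + ln ((t + a) ^+ 2 + b ^+ 2)) / 2 - 2 * ln t.

Definition log_maj_prim a b t :=
  half_prim b (t - a) + half_prim b (t + a) - 2 * (t * ln t - t).

Lemma sum_sqr_gt0 y b : 0 < b -> 0 < y ^+ 2 + b ^+ 2.
Proof. by move=> b0; rewrite ltr_wpDl ?sqr_ge0// exprn_gt0. Qed.

Lemma is_derive_log_maj_prim a b t : 0 < b -> 0 < t ->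
  is_derive t 1 (log_maj_prim a b) (log_maj a b t).
Proof.
move=> b0 t0.
have shift c : is_derive t 1 (fun t => half_prim b (t + c))
    (ln ((t + c) ^+ 2 + b ^+ 2) / 2).
  have k : is_derive t 1 (fun t : R => t + c) 1.
    by apply: is_derive_eq; rewrite addr0.
  have := @is_derive1_comp R (half_prim b) (fun t : R => t + c) t _ _
    (is_derive_half_prim _ b0) k.
  by rewrite mulr1.
have d1 := shift (- a); have d2 := shift a.
have d3 := @is_derive1_ln R _ t0.
rewrite /log_maj_prim /log_maj; apply: is_derive_eq.
rewrite ?scaler0 ?addr0 ?add0r /GRing.scale/=.
field; exact: lt0r_neq0.
Qed.

Lemma derivable_log_maj a b t : 0 < b -> 0 < t -> derivable (log_maj a b) t 1.
Proof.
move=> b0 t0.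
have lnsq c : is_derive t 1 (fun t => ln ((t + c) ^+ 2 + b ^+ 2))
   (((t + c) ^+ 2 + b ^+ 2)^-1 * (2 * (t + c))).
  have h := @is_derive1_ln R _ (sum_sqr_gt0 (t + c) b0).
  have k : is_derive t 1 (fun t : R => (t + c) ^+ 2 + b ^+ 2) (2 * (t + c)).
    by apply: is_derive_eq; rewrite ?scaler0 ?addr0 /GRing.scale/=; ring.
  exact: (@is_derive1_comp R (@ln R) (fun t : R => (t + c) ^+ 2 + b ^+ 2) t _ _ h k).
have d1 := lnsq (- a); have d2 := lnsq a.
have d3 := @is_derive1_ln R _ t0.
rewrite /log_maj.
exact: ex_derive.
Qed.

Lemma integral_log_maj a b T : 0 < b -> 1 < T ->
  (\int[lebesgue_measure]_(t in `[1%R, T]) (log_maj a b t)%:E =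
   (log_maj_prim a b T - log_maj_prim a b 1)%:E)%E.
Proof.
move=> b0 T1; apply: is_derive_integral => // x /andP[x1 _].
  by apply: is_derive_log_maj_prim => //; exact: lt_le_trans x1.
by apply: derivable_log_maj => //; exact: lt_le_trans x1.
Qed.

(** The linear terms of the three primitives cancel, which is why the whole stays bounded at
    infinity. *)
Lemma log_maj_primE a b t : log_maj_prim a b t =
  (t - a) / 2 * ln ((t - a) ^+ 2 + b ^+ 2) +
  (t + a) / 2 * ln ((t + a) ^+ 2 + b ^+ 2) - 2 * t * ln t +
  b * (atan ((t - a) / b) + atan ((t + a) / b)).
Proof. by rewrite /log_maj_prim /half_prim; field. Qed.

(** Each logarithm is compared with [2 * ln t] through [ln q <= q - 1]; the coefficients (t - a)/2
    and (t + a)/2, nonnegative as [|a| <= t], add up to t, so the main terms cancel. Each arctangent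
    is at most pi/2. *)
Lemma log_maj_prim_le a b t : 0 < b -> 0 < t -> `|a| <= t ->
  log_maj_prim a b t <= pi * b + (3 * a ^+ 2 + b ^+ 2) / t.
Proof.
move=> b0 t0 /[!ler_norml]/andP[at1 at2].
have H c : 0 <= t + c -> (t + c) / 2 * ln ((t + c) ^+ 2 + b ^+ 2) <=
   (t + c) / 2 * (2 * ln t + (((t + c) ^+ 2 + b ^+ 2) / t ^+ 2 - 1)).
  move=> tc; apply: ler_wpM2l; first by rewrite divr_ge0.
  have p := sum_sqr_gt0 (t + c) b0.
  set q := ((t + c) ^+ 2 + b ^+ 2) / t ^+ 2.
  have q0 : 0 < q by rewrite divr_gt0// exprn_gt0.
  have -> : (t + c) ^+ 2 + b ^+ 2 = t ^+ 2 * q.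
    by rewrite mulrC divfK// sqrf_eq0 lt0r_neq0.
  rewrite lnM ?posrE ?exprn_gt0// lnXn// mulr_natl lerD2l.
  exact: ln_le_subr1.
have A c : atan (c / b) <= pi / 2 by rewrite ltW// atan_ltpi2.
have {A} : b * (atan ((t - a) / b) + atan ((t + a) / b)) <= b * (pi / 2 + pi / 2).
  by rewrite ler_pM2l// lerD.
have := H (- a); have {H} := H a.
rewrite log_maj_primE.
have e : (t + - a) / 2 * (2 * ln t + (((t - a) ^+ 2 + b ^+ 2) / t ^+ 2 - 1)) +
 (t + a) / 2 * (2 * ln t + (((t + a) ^+ 2 + b ^+ 2) / t ^+ 2 - 1)) - 2 * t * ln t
 = (3 * a ^+ 2 + b ^+ 2) / t.
  by field; exact: lt0r_neq0.
move=> /(_ ltac:(lra)) h1 /(_ ltac:(lra)) h2 h3.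
rewrite -e; lra.
Qed.

(** Convexity of [x * ln x]: the left side is its tangent at [p]. *)
Lemma xlnx_ge_tangent p x : 0 < p -> 0 <= x -> x * (1 + ln p) - p <= x * ln x.
Proof.
move=> p0; rewrite le_eqVlt => /predU1P[<-|x0]; first by rewrite !mul0r; lra.
have := @onem_inv_le_ln (x / p); rewrite divr_gt0// => /(_ isT).
rewrite ln_div ?posrE// invf_div -(ler_pM2l x0).
have -> : x * (1 - p / x) = x - p by field; exact: lt0r_neq0.
by move=> h; lra.
Qed.

(** Since 1 - a and 1 + a are nonnegative, dropping [b ^+ 2] from the logarithms only lowers the
    sum, and the arctangents are nonnegative. What remains is the value at b = 0. *)
Lemma log_maj_prim1_ge_entropy a b : 0 < b -> 0 <= a <= 1 ->
  (1 - a) * ln (1 - a) + (1 + a) * ln (1 + a) <= log_maj_prim a b 1.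
Proof.
move=> b0 /andP[a0 a1].
have H x : 0 <= x -> x * ln x <= x / 2 * ln (x ^+ 2 + b ^+ 2).
  rewrite le_eqVlt => /predU1P[<-|x0]; first by rewrite !mul0r.
  have -> : x * ln x = x / 2 * ln (x ^+ 2).
    by rewrite lnXn// -mulr_natl; field.
  rewrite ler_pM2l ?divr_gt0// ler_ln ?posrE ?sum_sqr_gt0 ?exprn_gt0//.
  by rewrite lerDl sqr_ge0.
have h : 0 <= b * (atan ((1 - a) / b) + atan ((1 + a) / b)).
  apply: mulr_ge0; first exact: ltW.
  have f x : 0 <= x -> 0 <= atan (x / b).
    rewrite le_eqVlt => /predU1P[<-|x0]; first by rewrite mul0r atan0.
    by rewrite -[leLHS]atan0 ltW// lt_atan// divr_gt0.
  by rewrite addr_ge0// f//; lra.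
have := H (1 - a); have := H (1 + a).
move=> /(_ ltac:(lra)) h1 /(_ ltac:(lra)) h2.
rewrite log_maj_primE ln1; lra.
Qed.

(** The coefficient (1 - a)/2 is now nonpositive, but its logarithm is at most the other one;
    together the two terms are worth at least (1 + a)/2 - (a - 1)/2 = 1 copy of the larger
    logarithm, whose argument is at least 4. *)
Lemma log_maj_prim1_ge_large a b : 0 < b -> 1 <= a -> 1 / 5 <= log_maj_prim a b 1.
Proof.
move=> b0 a1.
have h : 0 <= b * (atan ((1 - a) / b) + atan ((1 + a) / b)).
  apply: mulr_ge0; first exact: ltW.
  have -> : (1 - a) / b = - ((a - 1) / b) by field; exact: lt0r_neq0.
  rewrite atanN addrC subr_ge0 ltW// lt_atan// ltr_pM2r ?invr_gt0//; lra.
have l4 : 1 / 2 <= ln ((1 + a) ^+ 2 + b ^+ 2).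
  apply: le_trans (onem_inv_le_ln (sum_sqr_gt0 _ b0)).
  have : ((1 + a) ^+ 2 + b ^+ 2)^-1 <= 4^-1.
    by rewrite lef_pV2 ?posrE ?sum_sqr_gt0//; nra.
  lra.
have lm : ln ((1 - a) ^+ 2 + b ^+ 2) <= ln ((1 + a) ^+ 2 + b ^+ 2).
  by rewrite ler_ln ?posrE ?sum_sqr_gt0//; nra.
rewrite log_maj_primE ln1.
have := ler_wpM2l (_ : 0 <= (a - 1) / 2) lm.
move=> /(_ ltac:(lra)); lra.
Qed.

Lemma log_maj_prim1_ge0 a b : 0 < b -> 0 <= a -> 0 <= log_maj_prim a b 1.
Proof.
move=> b0 a0; have [a1|a1] := leP a 1.
  apply: le_trans (log_maj_prim1_ge_entropy b0 _); last by rewrite a0.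
  have := @xlnx_ge_tangent 1 (1 - a) ltr01; have := @xlnx_ge_tangent 1 (1 + a) ltr01.
  rewrite ln1 => /(_ ltac:(lra)) h1 /(_ ltac:(lra)) h2; lra.
by apply: le_trans (log_maj_prim1_ge_large b0 (ltW a1)); lra.
Qed.

(** For a <= 1, the tangents of x ln x at 1/2 and 3/2 are used, the values of 1 - a and 1 + a at a =
    1/2. Their sum increases with a, so it is at least (3 ln(3/2) + ln(1/2))/2 = ln(27/16)/2 >= (1 -
    16/27)/2 = 11/54, just above 1/5. *)
Lemma log_maj_prim1_ge_half a b : 0 < b -> 1 / 2 <= a ->
  1 / 5 <= log_maj_prim a b 1.
Proof.
move=> b0 a0; have [a1|a1] := leP a 1; last exact: log_maj_prim1_ge_large (ltW _).
apply: le_trans (log_maj_prim1_ge_entropy b0 _); last by lra.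
have := @xlnx_ge_tangent (1 / 2) (1 - a) ltac:(lra) ltac:(lra).
have := @xlnx_ge_tangent (3 / 2) (1 + a) ltac:(lra) ltac:(lra).
have lm : ln (1 / 2) <= ln (3 / 2) :> R by rewrite ler_ln ?posrE; lra.
have : 11 / 27 <= 3 * ln (3 / 2) + ln (1 / 2) :> R.
  have -> : 3 * ln (3 / 2) + ln (1 / 2) = ln (27 / 16) :> R.
    have -> : 27 / 16 = (3 / 2) ^+ 3 * (1 / 2) :> R by field.
    have p : 0 < 3 / 2 :> R by lra.
    by rewrite [RHS]lnM ?posrE ?exprn_gt0 ?divr_gt0// lnXn// mulr_natl.
  by apply: le_trans (onem_inv_le_ln _); lra.
have := ler_wpM2l (_ : 0 <= a - 1 / 2) lm.
move=> /(_ ltac:(lra)); lra.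
Qed.

End log_potential.

(** * The symmetrised kernel *)

Section kernels.
Context {R : realType}.
Implicit Types a b c t x y : R.

(** Off 0 the exponential is 1/x^2; at 0 the factor [x] restores the conventional value 0. *)
Lemma measurable_inv : measurable_fun [set: R] (@GRing.inv R).
Proof.
rewrite (_ : GRing.inv = fun x => x * expR (- ln (x ^+ 2))); last first.
  apply/funext => x; have [->|x0] := eqVneq x 0; first by rewrite invr0 mul0r.
  by rewrite expRN lnK ?posrE ?exprn_even_gt0// expr2 invfM mulrA divff// mul1r.
apply: measurable_funM => //.
apply: measurableT_comp => //.
apply: measurable_funN.
apply: measurableT_comp => //.
Qed.

Lemma measurable_lne_EFin : measurable_fun [set: R] (fun x : R => lne x%:E).
Proof.
rewrite /lne; apply: measurable_fun_ifT => //.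
- exact: measurable_fun_ler.
- exact/measurable_EFinP.
Qed.

(* [Hker (a + i b)], written without the square root of the modulus. *)
Definition cart_Hker a b : \bar R :=
  (lne ((1 - a) ^+ 2 + b ^+ 2)%:E * 2^-1%:E + a%:E)%E.

Lemma measurable_cart_Hker d (T : measurableType d) (f g : T -> R) :
  measurable_fun setT f -> measurable_fun setT g ->
  measurable_fun setT (fun x : T => cart_Hker (f x) (g x)).
Proof.
move=> mf mg; apply: emeasurable_funD; last exact/measurable_EFinP.
apply: emeasurable_funM => //.
apply: (measurableT_comp measurable_lne_EFin).
by apply: measurable_funD; apply: measurable_funX => //; exact: measurable_funB.
Qed.

(** The linear parts [a] and [- a] cancel and leave half the logarithm of the product. Bounding that
    product by a positive [z] keeps the right side finite even where the kernel is -oo. *)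
Lemma cart_Hker_sym_le a b z : 0 < z ->
  ((1 - a) ^+ 2 + b ^+ 2) * ((1 + a) ^+ 2 + b ^+ 2) <= z ->
  (cart_Hker a b + cart_Hker (- a) (- b) <= (ln z / 2)%:E)%E.
Proof.
move=> z0; rewrite /cart_Hker opprK sqrrN.
have [x1|x1] := leP ((1 - a) ^+ 2 + b ^+ 2) 0.
  by rewrite le0_lneNy ?lee_fin// gt0_mulNye ?lte_fin ?invr_gt0// !addNye leNye.
have [x2|x2] := leP ((1 + a) ^+ 2 + b ^+ 2) 0.
  by rewrite (@le0_lneNy _ ((1 + a) ^+ 2 + b ^+ 2)%:E) ?lee_fin//
    gt0_mulNye ?lte_fin ?invr_gt0// addNye addeNy leNye.
rewrite !lne_EFin// -!EFinM -!EFinD lee_fin => h.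
have : ln (((1 - a) ^+ 2 + b ^+ 2) * ((1 + a) ^+ 2 + b ^+ 2)) <= ln z.
  by rewrite ler_ln ?posrE// mulr_gt0.
rewrite lnM ?posrE//; lra.
Qed.

(** The factor 4 leaves room for raising the height in [log_dom_maj_ge]; being a square, it also
    turns this into [log_maj] at the point 2i|w|, whose primitive is explicit. *)
Definition log_dom a b t := ln (1 + 4 * (a ^+ 2 + b ^+ 2) / t ^+ 2).

(* The symmetrised kernel has no sign, so it is subtracted from an integrable
   majorant: only the nonnegative functions [log_dom] and [log_gap] enter
   Tonelli's theorem. *)
Definition log_gap a b t : \bar R :=
  ((log_dom a b t)%:E -
   (cart_Hker (a / t) (b / t) + cart_Hker (- (a / t)) (- (b / t))))%E.

Lemma measurable_log_dom d (T : measurableType d) (f g h : T -> R) :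
  measurable_fun setT f -> measurable_fun setT g -> measurable_fun setT h ->
  measurable_fun setT (fun x : T => log_dom (f x) (g x) (h x)).
Proof.
move=> mf mg mh; rewrite /log_dom.
apply: measurableT_comp => //; apply: measurable_funD => //.
apply: measurable_funM.
  by apply: measurable_funM => //; apply: measurable_funD; exact: measurable_funX.
by apply: (measurableT_comp measurable_inv); exact: measurable_funX.
Qed.

Lemma measurable_log_gap d (T : measurableType d) (f g h : T -> R) :
  measurable_fun setT f -> measurable_fun setT g -> measurable_fun setT h ->
  measurable_fun setT (fun x : T => log_gap (f x) (g x) (h x)).
Proof.
move=> mf mg mh; rewrite /log_gap; apply: emeasurable_funB.
  by apply/measurable_EFinP; exact: measurable_log_dom.
have mq (k : T -> R) : measurable_fun setT k ->
    measurable_fun setT (fun x : T => k x / h x).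
  move=> mk; apply: measurable_funM => //.
  exact: (measurableT_comp measurable_inv).
by apply: emeasurable_funD; apply: measurable_cart_Hker;
  rewrite ?[X in measurable_fun _ X](_ : _ = \- (fun x : T => _ x / h x))//;
  (try apply: measurable_funN); exact: mq.
Qed.

Lemma log_dom_ge0 a b t : 0 <= log_dom a b t.
Proof.
by rewrite ln_ge0// lerDl divr_ge0 ?sqr_ge0// mulr_ge0// addr_ge0 ?sqr_ge0.
Qed.

Lemma log_gap_ge0 a b t : (0 <= log_gap a b t)%E.
Proof.
rewrite /log_gap; set x := a / t; set y := b / t.
have -> : log_dom a b t = ln (1 + 4 * (x ^+ 2 + y ^+ 2)).
  by rewrite /log_dom /x /y !exprMn exprVn; congr ln; ring.
have x2 := sqr_ge0 x; have y2 := sqr_ge0 y.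
rewrite sube_ge0; last by rewrite orbT.
apply: le_trans (@cart_Hker_sym_le _ _ ((1 + 4 * (x ^+ 2 + y ^+ 2)) ^+ 2) _ _) _.
- by rewrite exprn_gt0//; lra.
- by nra.
- by rewrite lnXn; [rewrite -mulr_natl lee_fin; lra|lra].
Qed.

Lemma log_dom_le_sqr a b t : log_dom a b t <= 4 * (a ^+ 2 + b ^+ 2) / t ^+ 2.
Proof.
have : 0 <= 4 * (a ^+ 2 + b ^+ 2) / t ^+ 2.
  by rewrite divr_ge0 ?sqr_ge0// mulr_ge0// addr_ge0 ?sqr_ge0.
rewrite /log_dom; move: (4 * _ / _) => q q0.
by apply: le_trans (ln_le_subr1 _) _; lra.
Qed.

Lemma log_dom_maj a b t : 0 < t -> 0 < a ^+ 2 + b ^+ 2 ->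
  log_dom a b t = log_maj 0 (2 * Num.sqrt (a ^+ 2 + b ^+ 2)) t.
Proof.
move=> t0 s0; rewrite /log_maj subr0 addr0 exprMn sqr_sqrtr ?ltW//.
rewrite /log_dom; have t20 : 0 < t ^+ 2 by rewrite exprn_gt0.
have -> : 1 + 4 * (a ^+ 2 + b ^+ 2) / t ^+ 2 =
  (t ^+ 2 + 2 ^+ 2 * (a ^+ 2 + b ^+ 2)) / t ^+ 2 by field; rewrite lt0r_neq0.
have s1 : 0 < t ^+ 2 + 2 ^+ 2 * (a ^+ 2 + b ^+ 2) by nra.
rewrite ln_div ?posrE// [ln (t ^+ 2)]lnXn// -[_ *+ 2]mulr_natl.
by field.
Qed.

(** Raising the height from |b| to c > 0 increases |1 - w^2/t^2| and removes the singularities. *)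
Lemma log_maj_le_gap a b c t : 0 < t -> 0 < c -> `|b| <= c ->
  ((log_dom a b t - log_maj a c t)%:E <= log_gap a b t)%E.
Proof.
move=> t0 c0 bc; rewrite /log_gap EFinB leeB//.
have e y : ((t + y) ^+ 2 + c ^+ 2) = t ^+ 2 * ((1 + y / t) ^+ 2 + (c / t) ^+ 2).
  by field; exact: lt0r_neq0.
have p y : 0 < (1 + y / t) ^+ 2 + (c / t) ^+ 2.
  by rewrite sum_sqr_gt0// divr_gt0.
have b2 : (b / t) ^+ 2 <= (c / t) ^+ 2.
  rewrite !exprMn ler_wpM2r ?sqr_ge0// -(real_normK (num_real b)).
  by rewrite lerXn2r ?nnegrE// ltW.
apply: le_trans (@cart_Hker_sym_le _ _ (((1 - a / t) ^+ 2 + (c / t) ^+ 2) *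
  ((1 + a / t) ^+ 2 + (c / t) ^+ 2)) _ _) _.
- by rewrite mulr_gt0// -mulNr.
- by rewrite ler_pM ?addr_ge0 ?sqr_ge0// lerD2l.
- have l u : 0 < u -> ln (t ^+ 2 * u) = 2 * ln t + ln u.
    by move=> u0; rewrite lnM ?posrE ?exprn_gt0// lnXn// mulr_natl.
  rewrite lee_fin /log_maj !e !l// lnM ?posrE//; last by rewrite -mulNr.
  rewrite mulNr; lra.
Qed.

(** This is |t^2 - w^2| <= t^2 + |w|^2 for w = a + ic, followed by the hypothesis on |w|^2. *)
Lemma log_dom_maj_ge a b c t : 0 < t -> 0 < c ->
  a ^+ 2 + c ^+ 2 <= 4 * (a ^+ 2 + b ^+ 2) -> log_maj a c t <= log_dom a b t.
Proof.
move=> t0 c0 h; rewrite /log_maj /log_dom.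
have t20 : 0 < t ^+ 2 by rewrite exprn_gt0.
have s0 : 0 < t ^+ 2 + 4 * (a ^+ 2 + b ^+ 2).
  by have := sqr_ge0 a; have := sqr_ge0 b; lra.
have -> : 1 + 4 * (a ^+ 2 + b ^+ 2) / t ^+ 2 =
  (t ^+ 2 + 4 * (a ^+ 2 + b ^+ 2)) / t ^+ 2 by field; rewrite lt0r_neq0.
rewrite ln_div ?posrE// lnXn// -[ln t *+ 2]mulr_natl.
have := sum_sqr_gt0 (t - a) c0; have := sum_sqr_gt0 (t + a) c0 => p1 p2.
have : ln (((t - a) ^+ 2 + c ^+ 2) * ((t + a) ^+ 2 + c ^+ 2)) <=
       ln ((t ^+ 2 + 4 * (a ^+ 2 + b ^+ 2)) ^+ 2).
  rewrite ler_ln ?posrE ?mulr_gt0 ?exprn_gt0//.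
  have -> : ((t - a) ^+ 2 + c ^+ 2) * ((t + a) ^+ 2 + c ^+ 2) =
    (t ^+ 2 + (a ^+ 2 + c ^+ 2)) ^+ 2 - (2 * t * a) ^+ 2 by ring.
  apply: (@le_trans _ _ ((t ^+ 2 + (a ^+ 2 + c ^+ 2)) ^+ 2)).
    by rewrite gerBl sqr_ge0.
  rewrite lerXn2r ?lerD2l// nnegrE; last exact: ltW.
  by rewrite !addr_ge0 ?sqr_ge0.
rewrite lnM ?posrE// lnXn// -[_ *+ 2]mulr_natl; lra.
Qed.

Lemma log_dom_le_gap a b t : 1 <= t -> a ^+ 2 <= 1 -> b ^+ 2 <= 1 ->
  ((log_dom a b t)%:E <= log_gap a b t + (2 * b ^+ 2 / t ^+ 2)%:E)%E.
Proof.
move=> t1 a1 b1.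
have x2 : (a / t) ^+ 2 <= 1.
  rewrite expr_div_n ler_pdivrMr ?exprn_gt0//; last by lra.
  by rewrite mul1r (le_trans a1)// exprn_ege1.
have y2 : (b / t) ^+ 2 <= 1.
  rewrite expr_div_n ler_pdivrMr ?exprn_gt0//; last by lra.
  by rewrite mul1r (le_trans b1)// exprn_ege1.
have -> : 2 * b ^+ 2 / t ^+ 2 = 2 * (b / t) ^+ 2 by rewrite expr_div_n; ring.
rewrite /log_gap; move: x2 y2; set x := a / t; set y := b / t => x2 y2.
have x0 := sqr_ge0 x; have y0 := sqr_ge0 y.
have : (cart_Hker x y + cart_Hker (- x) (- y) <= (2 * y ^+ 2)%:E)%E.
  apply: le_trans (@cart_Hker_sym_le _ _ (1 + 4 * y ^+ 2) _ _) _.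
  - by lra.
  (* Written so that every subtracted term is nonnegative when x^2 and y^2 are at most 1. *)
  - have -> : ((1 - x) ^+ 2 + y ^+ 2) * ((1 + x) ^+ 2 + y ^+ 2) =
      1 + 4 * y ^+ 2 - 2 * (x ^+ 2 * (1 - x ^+ 2)) - 2 * (y ^+ 2 * (1 - y ^+ 2))
       - (x ^+ 2 - y ^+ 2) ^+ 2 by ring.
    have := mulr_ge0 x0 (_ : 0 <= 1 - x ^+ 2).
    have := mulr_ge0 y0 (_ : 0 <= 1 - y ^+ 2).
    have := sqr_ge0 (x ^+ 2 - y ^+ 2).
    move=> h /(_ ltac:(lra)) h1 /(_ ltac:(lra)) h2; lra.
  - rewrite lee_fin; have := @ln_le_subr1 R (1 + 4 * y ^+ 2).
    by move=> /(_ ltac:(lra)); lra.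
case: (cart_Hker x y + _)%E => [s| |].
- by rewrite -EFinB -EFinD !lee_fin; lra.
- by rewrite leye_eq.
- by move=> _; rewrite /= leey.
Qed.

End kernels.

(** * Averages of the kernel *)

Section integrals.
Context {R : realType}.
Implicit Types a b c t x y : R.
Local Notation leb := (@lebesgue_measure R).

Lemma integral_inv_sqr c T : 0 <= c -> 0 < T ->
  (\int[leb]_(t in `[T, +oo[) (c / t ^+ 2)%:E = (c / T)%:E)%E.
Proof.
move=> c0 T0.
have dinv t : t != 0 -> is_derive t 1 (fun t : R => - (c * t^-1)) (c / t ^+ 2).
  move=> t0.
  have h := is_deriveV t0 (is_derive_id t (1:R)).
  apply: is_derive_eq.
  by rewrite /GRing.scale/= expr2 invfM; ring.
have pos t : T <= t -> t != 0 by move=> Tt; rewrite lt0r_neq0// (lt_le_trans T0).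
rewrite (@ge0_continuous_FTC2y _ _ (fun t => - (c * t^-1)) _ 0).
- by rewrite -EFinB opprK add0r.
- by move=> t Tt; rewrite divr_ge0// sqr_ge0.
- apply: derivable_within_continuous => t; rewrite in_itv/= andbT => /pos t0.
  apply: (@derivableM _ _ (cst c) (fun t => (t ^+ 2)^-1)).
    exact: derivable_cst.
  apply: (@derivableV _ _ (fun t : R => t ^+ 2)); first by rewrite expf_neq0.
  exact: exprn_derivable.
- rewrite -oppr0; apply: cvgN; rewrite -(mulr0 c); apply: cvgMr.
  apply/(@gtr0_cvgV0 _ _ _ _ id); last exact: cvg_id.
  exact: nbhs_pinfty_gt.
- by move=> t Tt; have [] := dinv t (pos t (ltW Tt)).
- apply: cvg_at_right_filter.
  have [d _] := dinv T (pos T (lexx _)).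
  by move/derivable1_diffP/differentiable_continuous : d.
- move=> t; rewrite in_itv/= andbT => Tt.
  have h := dinv t (pos t (ltW Tt)).
  by rewrite derive1E derive_val.
Qed.

Lemma measurable_log_dom1 a b : measurable_fun [set: R] (EFin \o log_dom a b).
Proof. by apply/measurable_EFinP; exact: measurable_log_dom. Qed.

Lemma measurable_log_gap1 a b : measurable_fun [set: R] (log_gap a b).
Proof. exact: (@measurable_log_gap R _ _ (cst a) (cst b) id). Qed.

Lemma integral_log_dom_tail a b T : 1 < T ->
  (\int[leb]_(t in `[1%R, +oo[) (log_dom a b t)%:E <=
   \int[leb]_(t in `[1%R, T]) (log_dom a b t)%:E +
   (4 * (a ^+ 2 + b ^+ 2) / T)%:E)%E.
Proof.
move=> T1; have m := measurable_log_dom1 a b.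
have ge0 t : (0 <= (log_dom a b t)%:E)%E by rewrite lee_fin log_dom_ge0.
have -> : `[1%R, +oo[%classic = `[1%R, T]%classic `|` `]T, +oo[%classic :> set R.
  by rewrite -itv_bndbnd_setU// bnd_simp ltW.
rewrite ge0_integral_setU//=.
- rewrite leeD2l// -(@integral_inv_sqr _ T)//; last exact: lt_trans T1.
    rewrite integral_itv_obnd_cbnd; last exact: measurable_funTS.
    apply: ge0_le_integral => //.
    - exact: measurable_funTS.
    - apply: measurable_funTS; apply/measurable_EFinP.
      apply: measurable_funM => //; apply: (measurableT_comp measurable_inv).
      exact: measurable_funX.
    - by move=> t _; rewrite lee_fin log_dom_le_sqr.
  by rewrite mulr_ge0// addr_ge0 ?sqr_ge0.
- exact: measurable_funTS.
- apply/disj_setPS => t [] /=; rewrite !in_itv/= andbT => /andP[_ tT] Tt.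
  by move: (lt_le_trans Tt tT); rewrite ltxx.
Qed.

Lemma integrable_log_maj a c T : 0 < c ->
  leb.-integrable `[1, T] (EFin \o log_maj a c).
Proof.
move=> c0; apply: continuous_compact_integrable; first exact: segment_compact.
apply: derivable_within_continuous => t; rewrite in_itv/= => /andP[t1 _].
by apply: derivable_log_maj => //; exact: lt_le_trans t1.
Qed.

Lemma integrable_log_dom a b T : leb.-integrable `[1, T] (EFin \o log_dom a b).
Proof.
have [s0|s0] := leP (a ^+ 2 + b ^+ 2) 0.
  rewrite (_ : _ \o _ = cst 0%E); first exact: integrable0.
  have -> : log_dom a b = cst 0.
    apply/funext => t; apply/eqP; rewrite eq_le log_dom_ge0 andbT.
    apply: le_trans (log_dom_le_sqr _ _ _) _.
    by rewrite mulr_le0_ge0 ?invr_ge0 ?sqr_ge0// mulr_ge0_le0.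
  by [].
apply: (@eq_integrable _ _ _ leb `[1, T]%classic _
  (EFin \o log_maj 0 (2 * Num.sqrt (a ^+ 2 + b ^+ 2)))) => //.
  move=> t; rewrite inE/= in_itv/= => /andP[t1 _].
  by rewrite log_dom_maj// (lt_le_trans _ t1).
by apply: integrable_log_maj; rewrite mulr_gt0// sqrtr_gt0.
Qed.

(** In substance, the average of the symmetrised kernel is at most [pi * c - log_maj_prim a c 1]. On
    [1, T], [log_dom] is split as ([log_dom] - [log_maj]) + [log_maj]: the first summand lies
    between 0 and [log_gap], the second is integrated explicitly. The additive form avoids
    differences of infinite integrals. *)
Lemma integral_log_dom_le_gap a b c : 0 < c -> `|b| <= c ->
  a ^+ 2 + c ^+ 2 <= 4 * (a ^+ 2 + b ^+ 2) ->
  (\int[leb]_(t in `[1%R, +oo[) (log_dom a b t)%:E <=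
   \int[leb]_(t in `[1%R, +oo[) log_gap a b t +
   (pi * c - log_maj_prim a c 1)%:E)%E.
Proof.
move=> c0 bc ac; apply/lee_addgt0Pr => e e0.
(* [C / T] collects the error term of [log_maj_prim_le] and the tail of [log_dom] beyond [T]. *)
set C := 3 * a ^+ 2 + c ^+ 2 + 4 * (a ^+ 2 + b ^+ 2).
have C0 : 0 <= C.
  by have := sqr_ge0 a; have := sqr_ge0 b; have := sqr_ge0 c; rewrite /C; lra.
pose T := 2 + `|a| + C / e.
have Ce : 0 <= C / e by rewrite divr_ge0// ltW.
have T1 : 1 < T by have := normr_ge0 a; rewrite /T; lra.
have T0 : 0 < T by exact: lt_trans T1.
have aT : `|a| <= T by rewrite /T; lra.
have CT : C / T <= e.
  rewrite ler_pdivrMr// mulrC -ler_pdivrMr// /T; have := normr_ge0 a; lra.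
have := log_maj_prim_le c0 T0 aT => pT.
apply: le_trans (integral_log_dom_tail a b T1) _.
have split : (\int[leb]_(t in `[1%R, T]) (log_dom a b t)%:E =
   \int[leb]_(t in `[1%R, T]) (log_dom a b t - log_maj a c t)%:E +
   (log_maj_prim a c T - log_maj_prim a c 1)%:E)%E.
  rewrite -integral_log_maj// -integralD//.
  - by apply: eq_integral => t _; rewrite -EFinD subrK.
  - have m1 : measurable (`[1, T]%classic : set (measurableTypeR R)) by [].
    have := integrableB m1 (integrable_log_dom a b T) (integrable_log_maj a T c0).
    apply: eq_integrable => // t _; rewrite /= EFinB.
  - exact: integrable_log_maj.
have le1 : (\int[leb]_(t in `[1%R, T]) (log_dom a b t - log_maj a c t)%:E <=
    \int[leb]_(t in `[1%R, +oo[) log_gap a b t)%E.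
  apply: (@le_trans _ _ (\int[leb]_(t in `[1%R, T]) log_gap a b t)%E).
    apply: ge0_le_integral => //.
    - move=> t; rewrite /= in_itv/= => /andP[t1 _].
      by rewrite lee_fin subr_ge0 log_dom_maj_ge// (lt_le_trans _ t1).
    - apply/measurable_EFinP; apply: measurable_funB.
      + by apply/measurable_EFinP; have /integrableP[] := integrable_log_dom a b T.
      + apply/measurable_EFinP.
        by have /integrableP[] := @integrable_log_maj a c T c0.
    - by apply: measurable_funTS; exact: measurable_log_gap1.
    - move=> t; rewrite /= in_itv/= => /andP[t1 _].
      by rewrite log_maj_le_gap// (lt_le_trans _ t1).
  apply: ge0_subset_integral => //.
  - by apply: measurable_funTS; exact: measurable_log_gap1.
  - by move=> t _; exact: log_gap_ge0.
  - by move=> t /=; rewrite !in_itv/= => /andP[->].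
rewrite split; apply: (le_trans (leeD2r _ (leeD2r _ le1))).
move: (integral leb _ (log_gap a b)) => J.
rewrite -!addeA -!EFinD; apply: leeD2l; rewrite lee_fin.
by move: CT pT; rewrite /C !mulrDl; lra.
Qed.

Lemma integral_log_dom_le_gap_small a b : a ^+ 2 <= 1 -> b ^+ 2 <= 1 ->
  (\int[leb]_(t in `[1%R, +oo[) (log_dom a b t)%:E <=
   \int[leb]_(t in `[1%R, +oo[) log_gap a b t + (2 * b ^+ 2)%:E)%E.
Proof.
move=> a1 b1.
have b0 : 0 <= 2 * b ^+ 2 by rewrite mulr_ge0// sqr_ge0.
have mb : measurable_fun (`[1%R, +oo[%classic : set R)
    (fun t : R => (2 * b ^+ 2 / t ^+ 2)%:E).
  apply: measurable_funTS; apply/measurable_EFinP.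
  apply: measurable_funM => //; apply: (measurableT_comp measurable_inv).
  exact: measurable_funX.
have mg : measurable_fun (`[1%R, +oo[%classic : set R) (log_gap a b).
  by apply: measurable_funTS; exact: measurable_log_gap1.
have bt t : (0 <= (2 * b ^+ 2 / t ^+ 2)%:E)%E by rewrite lee_fin divr_ge0// sqr_ge0.
have := @integral_inv_sqr _ 1 b0 ltr01; rewrite divr1 => <-.
rewrite -ge0_integralD//; last by move=> t _; exact: log_gap_ge0.
apply: ge0_le_integral => //.
- by move=> t _; rewrite lee_fin log_dom_ge0.
- by apply: measurable_funTS; exact: measurable_log_dom1.
- exact: emeasurable_funD.
- by move=> t; rewrite /= in_itv/= andbT => t1; exact: log_dom_le_gap.
Qed.

Lemma integral_log_dom_le_sqr a b :
  (\int[leb]_(t in `[1%R, +oo[) (log_dom a b t)%:E <=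
   (4 * (a ^+ 2 + b ^+ 2))%:E)%E.
Proof.
have s0 : 0 <= 4 * (a ^+ 2 + b ^+ 2) by rewrite mulr_ge0// addr_ge0 ?sqr_ge0.
have := @integral_inv_sqr _ 1 s0 ltr01; rewrite divr1 => <-.
apply: ge0_le_integral => //.
- by move=> t _; rewrite lee_fin log_dom_ge0.
- by apply: measurable_funTS; exact: measurable_log_dom1.
- apply: measurable_funTS; apply/measurable_EFinP.
  apply: measurable_funM => //; apply: (measurableT_comp measurable_inv).
  exact: measurable_funX.
- by move=> t _; rewrite lee_fin log_dom_le_sqr.
Qed.

(** With s = 2|w|, [log_dom] is [log_maj 0 s], whose average is at most pi s <= 4 s. *)
Lemma integral_log_dom_le_norm a b :
  (\int[leb]_(t in `[1%R, +oo[) (log_dom a b t)%:E <=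
   (8 * Num.sqrt (a ^+ 2 + b ^+ 2))%:E)%E.
Proof.
have [s0|s0] := leP (a ^+ 2 + b ^+ 2) 0.
  apply: le_trans (integral_log_dom_le_sqr a b) _.
  by rewrite lee_fin (@le_trans _ _ 0)// ?mulr_ge0 ?sqrtr_ge0// mulr_ge0_le0.
set s := 2 * Num.sqrt (a ^+ 2 + b ^+ 2).
have sp : 0 < s by rewrite mulr_gt0// sqrtr_gt0.
have s2 : s ^+ 2 = 4 * (a ^+ 2 + b ^+ 2).
  by rewrite exprMn sqr_sqrtr ?ltW//; ring.
apply/lee_addgt0Pr => e e0.
pose T := 2 + 2 * s ^+ 2 / e.
have Te : 0 <= 2 * s ^+ 2 / e by rewrite divr_ge0 ?mulr_ge0 ?sqr_ge0// ltW.
have T1 : 1 < T by rewrite /T; lra.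
have T0 : 0 < T by exact: lt_trans T1.
have CT : 2 * s ^+ 2 / T <= e.
  rewrite ler_pdivrMr// [e * T]mulrC -ler_pdivrMr// /T; lra.
have n0 : `|0 : R| <= T by rewrite normr0 ltW.
have := log_maj_prim_le sp T0 n0 => pT.
apply: le_trans (integral_log_dom_tail a b T1) _.
have -> : (\int[leb]_(t in `[1%R, T]) (log_dom a b t)%:E =
  \int[leb]_(t in `[1%R, T]) (log_maj 0 s t)%:E)%E.
  apply: eq_integral => t; rewrite inE/= in_itv/= => /andP[t1 _].
  by rewrite log_dom_maj// (lt_le_trans _ t1).
rewrite integral_log_maj// -s2 -!EFinD lee_fin.
have := log_maj_prim1_ge0 sp (lexx 0).
have : pi * s <= 4 * s by rewrite ler_pM2r//; have := @pihalf_lt2 R; lra.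
have -> : 8 * Num.sqrt (a ^+ 2 + b ^+ 2) = 4 * s by rewrite /s; ring.
move: CT pT; rewrite expr0n/= mulr0 add0r -mulrA; lra.
Qed.

Lemma log_gap_normr a b t : log_gap `|a| b t = log_gap a b t.
Proof.
have [a0|a0] := ger0P a; first by [].
rewrite /log_gap /log_dom sqrrN mulNr opprK; congr (_ - _)%E.
by rewrite addeC /cart_Hker !opprK !sqrrN; congr (_ * _ + _ + _)%E.
Qed.

Lemma log_dom_normr a b t : log_dom `|a| b t = log_dom a b t.
Proof. by rewrite /log_dom real_normK// num_real. Qed.

(* For |b| >= 1/40 the gain comes from [pi * |b|]; for smaller |b| and |a| >= 1/2
   the height is replaced by 1/40, whose cost [pi / 40 <= 1/10] is beaten by
   [log_maj_prim a (1/40) 1 >= 1/5]; near the origin the second order expansion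
   of the kernel suffices. *)
Lemma integral_log_dom_le_imag : exists2 k : R, 0 < k & forall a b,
  (\int[leb]_(t in `[1%R, +oo[) (log_dom a b t)%:E +
   (10^-1 * (1 <= a ^+ 2 + b ^+ 2)%R%:R)%:E <=
   \int[leb]_(t in `[1%R, +oo[) log_gap a b t +
   (k * Num.min `|b| (b ^+ 2))%:E)%E.
Proof.
(* Forced by |b| >= 1/40: there min(|b|, b^2) >= |b|/40, and 320/40 = 8 covers pi |b| <= 4 |b|
   together with 1/10 <= 4 |b|. *)
exists 320 => [|a b]; first by lra.
wlog a0 : a / 0 <= a.
  move=> h; have := h `|a| (normr_ge0 a).
  under eq_integral do rewrite log_dom_normr.
  under [X in (_ <= X + _)%E]eq_integral do rewrite log_gap_normr.
  by rewrite real_normK// num_real.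
have pi4 : pi < 4 :> R by have := @pihalf_lt2 R; lra.
have nb : `|b| ^+ 2 = b ^+ 2 by rewrite real_normK// num_real.
have addX (x y : \bar R) (u v w : R) : (x <= y + u%:E)%E -> u + v <= w ->
    (x + v%:E <= y + w%:E)%E.
  move=> h uvw; apply: (@le_trans _ _ (y + u%:E + v%:E)%E); first by rewrite leeD2r.
  by rewrite -addeA leeD2l// -EFinD lee_fin.
have ind : 10^-1 * (1 <= a ^+ 2 + b ^+ 2)%R%:R <= 10^-1 :> R.
  by case: (1 <= _); rewrite ?mulr1 ?mulr0 ?invr_ge0.
have [b1|b1] := leP (1 / 40) `|b|.
  have bp : 0 < `|b| by lra.
  apply: addX; first (apply: integral_log_dom_le_gap bp (lexx _) _).
    by rewrite nb; have := sqr_ge0 a; have := sqr_ge0 b; lra.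
  have p0 := log_maj_prim1_ge0 bp a0.
  have : pi * `|b| <= 4 * `|b| by rewrite ler_pM2r// ltW.
  have : 1 / 40 * `|b| <= Num.min `|b| (b ^+ 2).
    rewrite le_min; apply/andP; split; first lra.
    by rewrite -nb expr2 ler_pM2r.
  lra.
have b2 : b ^+ 2 <= 1 / 1600 by rewrite -nb; have := normr_ge0 b; nra.
have m0 : 0 <= Num.min `|b| (b ^+ 2) by rewrite le_min normr_ge0 sqr_ge0.
have [a1|a1] := leP (1 / 2) a.
  have d0 : 0 < 1 / 40 :> R by lra.
  apply: addX; first (apply: integral_log_dom_le_gap d0 (ltW b1) _).
    have a2 : 1 / 4 <= a ^+ 2 by nra.
    by have := sqr_ge0 b; lra.
  have := log_maj_prim1_ge_half d0 a1.
  have : pi * (1 / 40) <= 4 * (1 / 40) :> R by rewrite ler_pM2r// ltW.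
  lra.
have a2 : a ^+ 2 <= 1 / 4 by nra.
rewrite [(1 <= _)%R]lt_geF ?mulr0 ?adde0; last by lra.
apply: le_trans (integral_log_dom_le_gap_small _ _) _; [lra|lra|].
rewrite leeD2l// lee_fin min_r; first by have := sqr_ge0 b; lra.
by rewrite -nb expr2 ler_piMl ?normr_ge0//; lra.
Qed.

End integrals.

(** * Integration over the measure *)

Section domain_fubini.
Local Open Scope ereal_scope.
Context d1 d2 (T1 : measurableType d1) (T2 : measurableType d2) (R : realType).
Variables (m1 : {sigma_finite_measure set T1 -> \bar R})
  (m2 : {sigma_finite_measure set T2 -> \bar R}).
Variables (E : set T1) (f : T1 * T2 -> \bar R).
Hypotheses (mE : measurable E) (mf : measurable_fun setT f).
Hypothesis f0 : forall x y, E x -> 0 <= f (x, y).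

(** Extension by zero restores nonnegativity on the whole product. The functions [layer] below are
    nonnegative only for t > 0. *)
Let g := f \_ (E `*` setT).

Let g0 p : 0 <= g p.
Proof. by apply: erestrict_ge0 => -[x y] [/= Ex _]; exact: f0. Qed.

Let mg : measurable_fun setT g.
Proof.
apply/(measurable_restrictT _ _).1; first exact: measurableX.
exact: measurable_funTS.
Qed.

Let gE x y : g (x, y) = ((fun z => f (z, y)) \_ E) x.
Proof. by rewrite /g !patchE in_setX in_setT andbT. Qed.

Lemma ge0_measurable_fun_integral_dom :
  measurable_fun setT (fun y => \int[m1]_(x in E) f (x, y)).
Proof.
have := measurable_fun_fubini_tonelli_G (m1 := m1) g mg g0.
congr measurable_fun; apply/funext => y; rewrite /fubini_G [RHS]integral_mkcond.
by apply: eq_integral => x _; exact: gE.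
Qed.

Lemma ge0_fubini_dom :
  \int[m1]_(x in E) \int[m2]_y f (x, y) = \int[m2]_y \int[m1]_(x in E) f (x, y).
Proof.
transitivity (\int[m1]_x \int[m2]_y g (x, y)).
  rewrite integral_mkcond; apply: eq_integral => x _; rewrite patchE.
  case: ifPn => xE; last first.
    by rewrite integral0_eq// => y _; rewrite gE patchE (negbTE xE).
  by apply: eq_integral => y _; rewrite gE patchE xE.
rewrite (fubini_tonelli _ mg g0); apply: eq_integral => y _.
by rewrite [RHS]integral_mkcond; apply: eq_integral => x _; exact: gE.
Qed.

End domain_fubini.

Section integral_facts.
Local Open Scope ereal_scope.
Context d (T : measurableType d) (R : realType).

(** The positive part has finite integral, being dominated by [g]; were the integral of the negative
    part infinite, that of [f] would be -oo. *)
Lemma integrable_of_integral_ge0 (mu : {measure set T -> \bar R})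
    (f g : T -> \bar R) :
  measurable_fun setT f -> measurable_fun setT g -> (forall x, 0 <= g x) ->
  (forall x, f x <= g x) -> \int[mu]_x g x < +oo -> 0 <= \int[mu]_x f x ->
  mu.-integrable setT f.
Proof.
move=> mf mg g0 fg gfin; rewrite integralE => fge0.
have mfp := measurable_funepos mf; have mfn := measurable_funeneg mf.
have fp : \int[mu]_x f^\+ x < +oo.
  apply: le_lt_trans gfin; apply: ge0_le_integral => // x _.
  by rewrite funeposE ge_max fg g0.
have fn : \int[mu]_x f^\- x < +oo.
  rewrite ltey; apply/negP => /eqP fn; move: fge0; rewrite fn.
  by move: fp; case: (integral _ _ f^\+) => [r| |].
apply/integrableP; split => //.
rewrite (_ : \int[mu]_x `|f x| = \int[mu]_x (f^\+ x + f^\- x)).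
  by rewrite ge0_integralD// lte_add_pinfty.
by apply: eq_integral => x _; rewrite -[LHS]/((abse \o f) x) fune_abse.
Qed.

Lemma integral_if_cst (mu : {measure set T -> \bar R}) (P : T -> bool) (c : R) :
  (0 <= c)%R -> measurable [set x | P x] ->
  \int[mu]_x (if P x then c else 0)%:E = mu [set x | P x] * c%:E.
Proof.
move=> c0 mP.
transitivity (\int[mu]_x ((\1_[set x | P x] x)%:E * c%:E)).
  apply: eq_integral => x _; rewrite -EFinM indicE.
  case: ifPn => Px; first by rewrite mem_set ?mul1r.
  by rewrite memNset ?mul0r//; exact/negP.
rewrite ge0_integralZr//; last by apply/measurable_EFinP.
by rewrite integral_indic// setIT.
Qed.

Lemma ge0_le_integralD2 (mu : {measure set T -> \bar R})
    (f g h k : T -> \bar R) :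
  measurable_fun setT f -> measurable_fun setT g ->
  measurable_fun setT h -> measurable_fun setT k ->
  (forall x, 0 <= f x) -> (forall x, 0 <= g x) ->
  (forall x, 0 <= h x) -> (forall x, 0 <= k x) ->
  (forall x, f x + g x <= h x + k x) ->
  \int[mu]_x f x + \int[mu]_x g x <= \int[mu]_x h x + \int[mu]_x k x.
Proof.
move=> mf mg mh mk f0 g0 h0 k0 fghk; rewrite -!ge0_integralD//.
apply: ge0_le_integral => //; try exact: emeasurable_funD.
by move=> x _; exact: adde_ge0.
Qed.

End integral_facts.

(** * Bounds by the genus one weight *)

Section kernel_bounds.
Context {R : realType}.
Implicit Types a b t x : R.

(** At w = 1/zeta this is the integrand of [genus_one_integrable], except at the origin, where w = 0
    by convention makes it 0 instead of +oo. *)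
Definition genus_weight a b :=
  Num.min (Num.sqrt (a ^+ 2 + b ^+ 2)) (a ^+ 2 + b ^+ 2).

Lemma genus_weight_ge0 a b : 0 <= genus_weight a b.
Proof. by rewrite le_min sqrtr_ge0 addr_ge0 ?sqr_ge0. Qed.

Lemma measurable_genus_weight d (T : measurableType d) (f g : T -> R) :
  measurable_fun setT f -> measurable_fun setT g ->
  measurable_fun setT (fun x : T => genus_weight (f x) (g x)).
Proof.
move=> mf mg.
have m2 : measurable_fun setT (fun x : T => f x ^+ 2 + g x ^+ 2).
  by apply: measurable_funD; exact: measurable_funX.
apply: measurable_minr => //; apply: (measurableT_comp _ m2).
by apply: continuous_measurable_fun; exact: sqrt_continuous.
Qed.

(** Linear bound: log|1 - w| <= log(1 + |w|) <= |w| and a <= |w|. Quadratic bound: [ln x <= x - 1]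
    at x = |1 - w|^2 = 1 - 2a + |w|^2, where the added [a] cancels the linear term. *)
Lemma cart_Hker_le_weight a b : (cart_Hker a b <= (2 * genus_weight a b)%:E)%E.
Proof.
set w2 := a ^+ 2 + b ^+ 2.
have w20 : 0 <= w2 by rewrite addr_ge0 ?sqr_ge0.
have := sqr_sqrtr w20; have := sqrtr_ge0 w2; rewrite /genus_weight -/w2.
set w := Num.sqrt w2 => w0 ww2.
have aw : `|a| <= w.
  rewrite /w -sqrtr_sqr ler_sqrt//; rewrite /w2 lerDl sqr_ge0//.
have := aw; rewrite ler_norml => /andP[aw1 aw2].
rewrite /cart_Hker; have [x1|x1] := leP ((1 - a) ^+ 2 + b ^+ 2) 0.
  by rewrite le0_lneNy ?lee_fin// gt0_mulNye ?lte_fin ?invr_gt0// addNye leNye.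
have X : (1 - a) ^+ 2 + b ^+ 2 = 1 - 2 * a + w2 by rewrite /w2; ring.
rewrite lne_EFin// -EFinM -EFinD lee_fin minr_pMr// le_min; apply/andP; split.
  have : ln ((1 - a) ^+ 2 + b ^+ 2) <= ln ((1 + w) ^+ 2).
    by rewrite ler_ln ?posrE ?exprn_gt0//; [rewrite X -ww2|]; lra.
  have : ln (1 + w) <= w by apply: le_trans (ln_le_subr1 _) _; lra.
  rewrite lnXn; last lra.
  rewrite -[_ *+ 2]mulr_natl; lra.
have := ln_le_subr1 x1; rewrite {2}X; lra.
Qed.

Lemma genus_weight_scale x a b :
  genus_weight (x * a) (x * b) <= (`|x| + x ^+ 2) * genus_weight a b.
Proof.
have w0 := genus_weight_ge0 a b.
rewrite /genus_weight !exprMn -mulrDr sqrtrM ?sqr_ge0// sqrtr_sqr.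
have := sqr_ge0 x; have := normr_ge0 x.
have [h|h] := leP (Num.sqrt (a ^+ 2 + b ^+ 2)) (a ^+ 2 + b ^+ 2).
  rewrite ge_min; set s := Num.sqrt _ => x0 x2.
  by rewrite mulrDl lerDl mulr_ge0// sqrtr_ge0.
rewrite ge_min => x0 x2; apply/orP; right.
by rewrite mulrDl lerDr mulr_ge0// addr_ge0 ?sqr_ge0.
Qed.

Lemma log_dom_le_weight a b t : 1 <= t -> log_dom a b t <= 4 * genus_weight a b.
Proof.
move=> t1; have t0 : 0 < t by exact: lt_le_trans t1.
set w2 := a ^+ 2 + b ^+ 2.
have w20 : 0 <= w2 by rewrite addr_ge0 ?sqr_ge0.
have := sqr_sqrtr w20; have := sqrtr_ge0 w2; rewrite /genus_weight -/w2.
set w := Num.sqrt w2 => w0 ww2.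
have t2 : 1 <= t ^+ 2 by rewrite exprn_ege1.
rewrite minr_pMr// le_min; apply/andP; split.
  have lew : 1 + 4 * w2 / t ^+ 2 <= (1 + 2 * w) ^+ 2.
    have : 4 * w2 / t ^+ 2 <= 4 * w2.
      by rewrite ler_pdivrMr ?(lt_le_trans ltr01)// ler_peMr// mulr_ge0.
    by rewrite -ww2; lra.
  have q0 : 0 <= 4 * w2 / t ^+ 2 by rewrite divr_ge0 ?sqr_ge0// mulr_ge0.
  apply: (@le_trans _ _ (ln ((1 + 2 * w) ^+ 2))).
    by rewrite /log_dom -/w2 ler_ln ?posrE//; lra.
  rewrite lnXn; last lra.
  rewrite -[_ *+ 2]mulr_natl.
  have : ln (1 + 2 * w) <= 2 * w by apply: le_trans (ln_le_subr1 _) _; lra.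
  lra.
apply: le_trans (log_dom_le_sqr _ _ _) _; rewrite -/w2.
by rewrite ler_pdivrMr ?(lt_le_trans ltr01)// ler_peMr// mulr_ge0.
Qed.

Lemma integral_log_dom_le_weight a b :
  (\int[lebesgue_measure]_(t in `[1%R, +oo[) (log_dom a b t)%:E <=
   (8 * genus_weight a b)%:E)%E.
Proof.
rewrite /genus_weight minr_pMr// EFin_min le_min integral_log_dom_le_norm/=.
apply: le_trans (integral_log_dom_le_sqr a b) _.
by rewrite lee_fin ler_wpM2r ?addr_ge0 ?sqr_ge0//; lra.
Qed.

End kernel_bounds.

(** * Averaging and layer cake over an abstract measure space *)

Section abstract.
Local Open Scope ereal_scope.
Context d (T : measurableType d) (R : realType).
Variable mu : {sigma_finite_measure set T -> \bar R}.
Local Notation leb := (@lebesgue_measure R).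

Section kernel_average.
Variables a b : T -> R.
Hypotheses (ma : measurable_fun setT a) (mb : measurable_fun setT b).
Hypothesis weight_fin : \int[mu]_z (genus_weight (a z) (b z))%:E < +oo.
Hypothesis pot_ge0 :
  forall x : R, 0 <= \int[mu]_z cart_Hker (x * a z)%R (x * b z)%R.

Variable k : R.
Hypothesis k0 : (0 < k)%R.
Hypothesis kP : forall x y : R,
  \int[leb]_(t in `[1%R, +oo[) (log_dom x y t)%:E +
  (10^-1 * (1 <= x ^+ 2 + y ^+ 2)%R%:R)%:E <=
  \int[leb]_(t in `[1%R, +oo[) log_gap x y t + (k * Num.min `|y| (y ^+ 2))%:E.

Let mweight : measurable_fun setT (fun z => (genus_weight (a z) (b z))%:E).
Proof. by apply/measurable_EFinP; exact: measurable_genus_weight. Qed.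

Let weight_ge0 z : 0 <= (genus_weight (a z) (b z))%:E.
Proof. by rewrite lee_fin genus_weight_ge0. Qed.

Let scaled_weight_fin (c : R) : (0 <= c)%R ->
  \int[mu]_z (c * genus_weight (a z) (b z))%:E < +oo.
Proof.
move=> c0; under eq_integral do rewrite EFinM.
by rewrite ge0_integralZl// lte_mul_pinfty.
Qed.

Let mscaled_weight (c : R) :
  measurable_fun setT (fun z => (c * genus_weight (a z) (b z))%:E).
Proof.
apply/measurable_EFinP; apply: measurable_funM => //.
exact: measurable_genus_weight.
Qed.

Let integrable_cart_Hker (x : R) :
  mu.-integrable setT (fun z => cart_Hker (x * a z) (x * b z)).
Proof.
apply: (@integrable_of_integral_ge0 _ _ _ mu _
  (fun z => (2 * (`|x| + x ^+ 2) * genus_weight (a z) (b z))%:E)) => //.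
- by apply: measurable_cart_Hker; apply: measurable_funM.
- move=> z; rewrite lee_fin mulr_ge0 ?genus_weight_ge0//.
  by rewrite mulr_ge0// addr_ge0 ?sqr_ge0.
- move=> z; apply: le_trans (cart_Hker_le_weight _ _) _.
  by rewrite lee_fin -mulrA ler_pM2l// genus_weight_scale.
- by apply: scaled_weight_fin; rewrite mulr_ge0// addr_ge0 ?sqr_ge0.
Qed.

Let mdom (t : R) : measurable_fun setT (fun z => (log_dom (a z) (b z) t)%:E).
Proof. by apply/measurable_EFinP; exact: measurable_log_dom. Qed.

Let integrable_dom (t : R) : (1 <= t)%R ->
  mu.-integrable setT (fun z => (log_dom (a z) (b z) t)%:E).
Proof.
move=> t1; apply: (@le_integrable _ _ _ mu _ _ _
    (fun z => (4 * genus_weight (a z) (b z))%:E)) => //.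
  move=> z _; rewrite !abse_EFin lee_fin !ger0_norm ?log_dom_ge0//.
    exact: log_dom_le_weight.
  by rewrite mulr_ge0// genus_weight_ge0.
apply/integrableP; split => //.
under eq_integral do rewrite abse_EFin ger0_norm ?mulr_ge0 ?genus_weight_ge0//.
exact: scaled_weight_fin.
Qed.

(** The subtracted kernels integrate to the sum of the potentials at 1/t and -1/t, which is
    nonnegative. Their integrability, itself a consequence of positivity, is what allows the
    integral to be split. *)
Let integral_gap_le_dom (t : R) : (1 <= t)%R ->
  \int[mu]_z log_gap (a z) (b z) t <= \int[mu]_z (log_dom (a z) (b z) t)%:E.
Proof.
move=> t1; pose x := (t^-1)%R.
have e z : log_gap (a z) (b z) t = (log_dom (a z) (b z) t)%:E -
    (cart_Hker (x * a z) (x * b z) + cart_Hker (- x * a z) (- x * b z)).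
  by rewrite /log_gap !mulNr !(mulrC x).
under eq_integral do rewrite e.
have i1 := integrable_cart_Hker x; have i2 := integrable_cart_Hker (- x).
rewrite integralB//; [|exact: integrable_dom|exact: integrableD].
rewrite integralD//.
have h : 0 <= \int[mu]_z cart_Hker (x * a z) (x * b z) +
   \int[mu]_z cart_Hker (- x * a z) (- x * b z) by rewrite adde_ge0.
by rewrite -[leRHS]sube0 leeB.
Qed.

Let mgap2 : measurable_fun setT (fun p : R * T => log_gap (a p.2) (b p.2) p.1).
Proof. by apply: measurable_log_gap => //; exact: measurableT_comp. Qed.

Let mdom2 :
  measurable_fun setT (fun p : R * T => (log_dom (a p.2) (b p.2) p.1)%:E).
Proof.
by apply/measurable_EFinP; apply: measurable_log_dom => //; exact: measurableT_comp.
Qed.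

Let dom2_ge0 (t : R) (z : T) : 0 <= (log_dom (a z) (b z) t)%:E.
Proof. by rewrite lee_fin log_dom_ge0. Qed.

Let gap2_ge0 (t : R) (z : T) : 0 <= log_gap (a z) (b z) t.
Proof. exact: log_gap_ge0. Qed.

Let J : set R := `[1%R, +oo[%classic.
Let mJ : measurable J. Proof. exact: measurable_itv. Qed.

Let mint_gap :
  measurable_fun setT (fun z => \int[leb]_(t in J) log_gap (a z) (b z) t).
Proof.
exact: (ge0_measurable_fun_integral_dom leb mJ mgap2
  (fun t z _ => gap2_ge0 t z)).
Qed.

Let mint_dom :
  measurable_fun setT (fun z => \int[leb]_(t in J) (log_dom (a z) (b z) t)%:E).
Proof.
exact: (ge0_measurable_fun_integral_dom leb mJ mdom2
  (fun t z _ => dom2_ge0 t z)).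
Qed.

Let mean_gap_le_dom :
  \int[mu]_z \int[leb]_(t in J) log_gap (a z) (b z) t <=
  \int[mu]_z \int[leb]_(t in J) (log_dom (a z) (b z) t)%:E.
Proof.
rewrite -(ge0_fubini_dom leb mu mJ mgap2 (fun t z _ => gap2_ge0 t z)).
rewrite -(ge0_fubini_dom leb mu mJ mdom2 (fun t z _ => dom2_ge0 t z)).
apply: ge0_le_integral => //.
- by move=> t _; apply: integral_ge0.
- apply: measurable_funTS.
  exact: (measurable_fun_fubini_tonelli_F (m2 := mu) _ mgap2
    (fun p => log_gap_ge0 _ _ _)).
- apply: measurable_funTS.
  exact: (measurable_fun_fubini_tonelli_F (m2 := mu) _ mdom2
    (fun p => dom2_ge0 _ _)).
- move=> t; rewrite /J/= in_itv/= andbT; exact: integral_gap_le_dom.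
Qed.

Let mean_dom_fin :
  \int[mu]_z \int[leb]_(t in J) (log_dom (a z) (b z) t)%:E < +oo.
Proof.
apply: (@le_lt_trans _ _ (\int[mu]_z (8 * genus_weight (a z) (b z))%:E)).
  apply: ge0_le_integral => //.
  - by move=> z _; apply: integral_ge0.
  - by move=> z _; exact: integral_log_dom_le_weight.
exact: scaled_weight_fin.
Qed.

Lemma measure_outer_le_imag :
  mu [set z | 1 <= a z ^+ 2 + b z ^+ 2]%R <=
  (10 * k)%:E * \int[mu]_z (Num.min `|b z| (b z ^+ 2))%:E.
Proof.
set P := [set z | _].
have mb1 : measurable_fun setT (fun z => (Num.min `|b z| (b z ^+ 2))%:E).
  apply/measurable_EFinP; apply: measurable_minr; last exact: measurable_funX.
  exact: measurableT_comp.
have b1_ge0 z : (0 <= Num.min `|b z| (b z ^+ 2))%R.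
  by rewrite le_min normr_ge0 sqr_ge0.
have mPb : measurable_fun setT (fun z => 1 <= a z ^+ 2 + b z ^+ 2)%R.
  apply: measurable_fun_ler => //.
  by apply: measurable_funD; exact: measurable_funX.
have mP : measurable P.
  by rewrite -[P]setTI; exact: (mPb measurableT [set true]).
pose i := fun z => (10^-1 * (1 <= a z ^+ 2 + b z ^+ 2)%R%:R)%R : R.
have i0 z : (0 <= i z)%R by rewrite mulr_ge0.
have mi : measurable_fun setT (fun z => (i z)%:E).
  apply/measurable_EFinP; apply: measurable_funM => //.
  rewrite (_ : (fun _ => _) =
      (fun z => if (1 <= a z ^+ 2 + b z ^+ 2)%R then 1 else 0)%R).
    exact: measurable_fun_ifT.
  by apply/funext => z; case: ifP.
have intI : \int[mu]_z (i z)%:E = mu P * (10^-1)%:E.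
  rewrite -integral_if_cst//; apply: eq_integral => z _.
  by rewrite /i; case: ifP => _; rewrite ?mulr1 ?mulr0.
have sum_le : \int[mu]_z \int[leb]_(t in J) (log_dom (a z) (b z) t)%:E +
    \int[mu]_z (i z)%:E <=
    \int[mu]_z \int[leb]_(t in J) log_gap (a z) (b z) t +
    \int[mu]_z (k * Num.min `|b z| (b z ^+ 2))%:E.
  have mk : measurable_fun setT (fun z => (k * Num.min `|b z| (b z ^+ 2))%:E).
    by apply/measurable_EFinP; apply: measurable_funM => //; exact/measurable_EFinP.
  apply: ge0_le_integralD2 => //.
  - by move=> z; exact: integral_ge0.
  - by move=> z; exact: integral_ge0.
  - by move=> z; rewrite lee_fin mulr_ge0// ltW.
(* Now the mean of [log_dom] stands on both sides; being finite by [mean_dom_fin], it cancels and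
   leaves a tenth of [mu P] on the left. *)
have := le_trans sum_le (leeD2r _ mean_gap_le_dom).
rewrite leeD2lE; last first.
  by rewrite ge0_fin_numE//; apply: integral_ge0 => z _; exact: integral_ge0.
have -> : \int[mu]_z (k * Num.min `|b z| (b z ^+ 2))%:E =
    k%:E * \int[mu]_z (Num.min `|b z| (b z ^+ 2))%:E.
  under eq_integral do rewrite EFinM.
  by rewrite ge0_integralZl// ?lee_fin ?ltW// => z _; rewrite lee_fin.
rewrite intI -lee_pdivlMr ?invr_gt0// invrK => h.
by apply: (le_trans h); rewrite muleAC -EFinM (mulrC k).
Qed.

End kernel_average.

Section layer_cake.
Variable b : T -> R.
Hypothesis mb : measurable_fun setT b.

(** For [b] = [im_inv] this is [levin_tsuji] by conversion. *)
Definition level_measure (t : R) : \bar R := mu [set z | t^-1 <= `|b z|]%R.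

Let mlevel : measurable_fun setT (fun p : R * T => p.1^-1 <= `|b p.2|)%R.
Proof.
apply: measurable_fun_ler; first exact: (measurableT_comp measurable_inv).
by apply: measurableT_comp => //; exact: measurableT_comp.
Qed.

Let layer (k : nat) (p : R * T) : \bar R :=
  (if p.1^-1 <= `|b p.2| then p.1 ^- k else 0)%:E.

Let mlayer k : measurable_fun setT (layer k).
Proof.
apply/measurable_EFinP; apply: measurable_fun_ifT => //.
by apply: (measurableT_comp measurable_inv); exact: measurable_funX.
Qed.

Let layer_ge0 k (t : R) z : (0 < t)%R -> 0 <= layer k (t, z).
Proof.
move=> t0; rewrite lee_fin /=; case: ifP => // _.
by rewrite invr_ge0 exprn_ge0// ltW.
Qed.

Let level_layer k (t : R) : (0 < t)%R ->
  level_measure t * (t ^- k)%:E = \int[mu]_z layer k (t, z).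
Proof.
move=> t0; rewrite -integral_if_cst//.
  by rewrite invr_ge0 exprn_ge0// ltW.
rewrite -[X in measurable X]setTI.
have mlt : measurable_fun setT (fun z => t^-1 <= `|b z|)%R.
  by apply: measurable_fun_ler => //; exact: measurableT_comp.
exact: (mlt measurableT [set true]).
Qed.

Let integral_level_layer k (E : set R) : measurable E ->
  (forall t, E t -> (0 < t)%R) ->
  \int[leb]_(t in E) (level_measure t * (t ^- k)%:E) =
  \int[mu]_z \int[leb]_(t in E) layer k (t, z).
Proof.
move=> mE E0; rewrite -(ge0_fubini_dom leb mu mE (mlayer k)); last first.
  by move=> t z /E0; exact: layer_ge0.
by apply: eq_integral => t; rewrite inE => /E0; exact: level_layer.
Qed.

(** On [u, v] the condition 1/t <= |b z| holds throughout, and t^-k is at least v^-k. *)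
Let layer_interval k (E : set R) (u v : R) z : measurable E ->
  (forall t, E t -> (0 < t)%R) -> `[u, v]%classic `<=` E ->
  (u < v)%R -> (u^-1 <= `|b z|)%R ->
  (v ^- k * (v - u))%:E <= \int[leb]_(t in E) layer k (t, z).
Proof.
move=> mE E0 uvE uv ub.
have pos t : (u <= t <= v)%R -> (0 < t)%R.
  by move=> ht; apply: E0; apply: uvE; rewrite /= in_itv.
have u0 : (0 < u)%R by apply: pos; rewrite lexx ltW.
have v0 : (0 < v)%R by apply: pos; rewrite lexx andbT ltW.
have mlz : measurable_fun setT (fun t => layer k (t, z)).
  exact: (measurableT_comp (mlayer k) (pair2_measurable z)).
apply: (@le_trans _ _ (\int[leb]_(t in `[u, v]) layer k (t, z))); last first.
  apply: ge0_subset_integral => //; first exact: measurable_funTS.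
  by move=> t /E0; exact: layer_ge0.
have -> : (v ^- k * (v - u))%:E = \int[leb]_(t in `[u, v]) (v ^- k)%:E.
  by rewrite integral_cst//= lebesgue_measure_itv/= lte_fin uv EFinM.
apply: ge0_le_integral => //.
- by move=> t _; rewrite lee_fin invr_ge0 exprn_ge0// ltW.
- exact: measurable_funTS.
- move=> t; rewrite /= in_itv/= => utv; have t0 := pos _ utv.
  move/andP: utv => [ut tv]; rewrite lee_fin /= ifT.
    by rewrite lef_pV2 ?posrE ?exprn_gt0// lerXn2r ?nnegrE// ltW.
  by apply: le_trans ub; rewrite lef_pV2.
Qed.

(** After Tonelli the inequality is pointwise in z. Put p = 1/|b z|. If 2p <= r, the interval
    [p, 2p] lies in ]0, r] and contributes at least r|b z|/4 to the first term; otherwise [2p, 4p]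
    lies in [r, +oo[ and contributes at least (r|b z|)^2/32 to the second, whence the constant
    32. *)
Lemma integral_imag_le_level (r : R) : (0 < r)%R ->
  \int[mu]_z (Num.min `|r * b z| ((r * b z) ^+ 2))%:E <=
  32%:E * (r%:E * \int[leb]_(t in `]0%R, r]) (level_measure t * (t ^- 2)%:E) +
    (r ^+ 2)%:E *
      \int[leb]_(t in `[r, +oo[) (level_measure t * (t ^- 3)%:E)).
Proof.
move=> r0.
have E1 (t : R) : `]0%R, r]%classic t -> (0 < t)%R by rewrite /= in_itv/= => /andP[].
have E2 (t : R) : `[r, +oo[%classic t -> (0 < t)%R.
  by rewrite /= in_itv/= andbT; exact: lt_le_trans.
have m1 : measurable (`]0%R, r]%classic : set R) by [].
have m2 : measurable (`[r, +oo[%classic : set R) by [].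
have r20 : (0 <= r ^+ 2)%R by rewrite sqr_ge0.
rewrite !integral_level_layer//.
have i1 z : 0 <= \int[leb]_(t in `]0%R, r]) layer 2 (t, z).
  by apply: integral_ge0 => t /E1; exact: layer_ge0.
have i2 z : 0 <= \int[leb]_(t in `[r, +oo[) layer 3 (t, z).
  by apply: integral_ge0 => t /E2; exact: layer_ge0.
have mi1 : measurable_fun setT (fun z => \int[leb]_(t in `]0%R, r]) layer 2 (t, z)).
  apply: (ge0_measurable_fun_integral_dom leb m1 (mlayer 2)).
  by move=> t z /E1; exact: layer_ge0.
have mi2 : measurable_fun setT (fun z => \int[leb]_(t in `[r, +oo[) layer 3 (t, z)).
  apply: (ge0_measurable_fun_integral_dom leb m2 (mlayer 3)).
  by move=> t z /E2; exact: layer_ge0.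
have c1 z : 0 <= r%:E * \int[leb]_(t in `]0%R, r]) layer 2 (t, z).
  by rewrite mule_ge0// lee_fin ltW.
have c2 z : 0 <= (r ^+ 2)%:E * \int[leb]_(t in `[r, +oo[) layer 3 (t, z).
  by rewrite mule_ge0.
have mc1 := measurable_funeM r%:E mi1.
have mc2 := measurable_funeM (r ^+ 2)%:E mi2.
rewrite -ge0_integralZl//; last by rewrite lee_fin ltW.
rewrite -ge0_integralZl// -ge0_integralD// -ge0_integralZl//; last 2 first.
  exact: emeasurable_funD.
  by move=> z _; rewrite adde_ge0.
apply: ge0_le_integral => //.
- by move=> z _; rewrite lee_fin le_min normr_ge0 sqr_ge0.
- apply/measurable_EFinP.
  have mrb : measurable_fun setT (fun z => r * b z)%R by exact: measurable_funM.
  by apply: measurable_minr; [exact: measurableT_comp|exact: measurable_funX].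
- by apply: measurable_funeM; exact: emeasurable_funD.
move=> z _; rewrite normrM (gtr0_norm r0).
(* Treated apart because p would be 0 by convention; the left side vanishes. *)
have [->|bz] := eqVneq (b z) 0%R.
  by rewrite normr0 mulr0 expr0n/= minxx mule_ge0// adde_ge0.
have c0 : (0 < `|b z|)%R by rewrite normr_gt0.
set c := (`|b z|)%R in c0 *.
have -> : ((r * b z) ^+ 2 = (r * c) ^+ 2)%R.
  by rewrite !exprMn real_normK// num_real.
pose p := (c^-1)%R; have p0 : (0 < p)%R by rewrite invr_gt0.
have cp : (c = p^-1)%R by rewrite invrK.
have pb : (p^-1 <= `|b z|)%R by rewrite -cp.
have [h|h] := leP (2 * p)%R r.
  apply: (@le_trans _ _ (32%:E * (r%:E * ((2 * p) ^- 2 * (2 * p - p))%:E))).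
    rewrite -!EFinM lee_fin ge_min; apply/orP; left.
    have -> : (32 * (r * ((2 * p) ^- 2 * (2 * p - p))) = 8 * (r * c))%R.
      by rewrite cp; field; exact: lt0r_neq0.
    by have := mulr_gt0 r0 c0; lra.
  rewrite lee_wpmul2l//; apply: le_trans (leeDl _ (c2 z)).
  rewrite lee_wpmul2l ?lee_fin ?(ltW r0)//.
  apply: layer_interval => //; last by lra.
  by move=> t; rewrite /= !in_itv/= => /andP[pt tp]; apply/andP; split; lra.
have pb2 : ((2 * p)^-1 <= `|b z|)%R.
  by apply: le_trans pb; rewrite lef_pV2 ?posrE//; lra.
apply: (@le_trans _ _ (32%:E * ((r ^+ 2)%:E * ((4 * p) ^- 3 * (4 * p - 2 * p))%:E))).
  rewrite -!EFinM lee_fin ge_min; apply/orP; right.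
  have -> // : (32 * (r ^+ 2 * ((4 * p) ^- 3 * (4 * p - 2 * p))) = (r * c) ^+ 2)%R.
  by rewrite cp; field; exact: lt0r_neq0.
rewrite lee_wpmul2l//; apply: le_trans (leeDr _ (c1 z)).
rewrite lee_wpmul2l//.
apply: layer_interval => //; last by lra.
by move=> t; rewrite /= !in_itv/= andbT => /andP[pt tp]; lra.
Qed.

End layer_cake.

End abstract.

(** * The complex plane *)

Section sigma_finite_of.
Context d (T : measurableType d) (R : realType).
Variables (mu : {measure set T -> \bar R}) (mu_sf : sigma_finite setT mu).

(* [mu] itself; the alias carries the sigma-finite structure. *)
Definition sigma_finite_of of sigma_finite setT mu : set T -> \bar R := mu.

HB.instance Definition _ := Measure.on (sigma_finite_of mu_sf).

HB.instance Definition _ := Measure_isSigmaFinite.Build _ _ _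
  (sigma_finite_of mu_sf) mu_sf.

End sigma_finite_of.

Section borel_complex.
Context {R : realType}.
Implicit Types (z : R[i]) (x r : R).

(** The sigma-algebra is generated by the open sets of [R[i]^o], so it suffices that preimages of
    open half-lines are open. *)
Lemma lipschitz_measurable (L : R[i] -> R) :
  (forall z y : R[i], `|L z - L y| <= ComplexField.Normc.normc (z - y)) ->
  measurable_fun (setT : set (borelC R)) L.
Proof.
move=> lip; apply: (measurability _ (RGenOInfty.measurableE R)).
move=> _ [_ [x ->] <-]; apply: sub_sigma_algebra; rewrite setTI.
suff : @open R[i]^o (L @^-1` `]x, +oo[) by [].
rewrite openE => z /=.
rewrite in_itv/= andbT => xz; apply/nbhs_ballP.
(* Radii of balls in [R[i]^o] are themselves elements of [R[i]], hence the embedding. *)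
exists ((L z - x)%:C)%C => /=; first by rewrite ltcR subr_gt0.
move=> y /=; rewrite /ball/= normc_def => h.
rewrite in_itv/= andbT; have := lip z y.
have e : ComplexField.Normc.normc (z - y) =
   Num.sqrt (complex.Re (z - y) ^+ 2 + complex.Im (z - y) ^+ 2).
  by case: (z - y).
move: h; rewrite ltcR -e => h /le_lt_trans/(_ h).
rewrite ltr_norml; lra.
Qed.

Lemma measurable_Re : measurable_fun (setT : set (borelC R)) (@complex.Re R).
Proof.
apply: lipschitz_measurable => z y; rewrite -raddfB /=.
case: (z - y) => u v /=; rewrite -sqrtr_sqr ler_wsqrtr// lerDl sqr_ge0//.
Qed.

Lemma measurable_Im : measurable_fun (setT : set (borelC R)) (@complex.Im R).
Proof.
apply: lipschitz_measurable => z y; rewrite -raddfB /=.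
case: (z - y) => u v /=; rewrite -sqrtr_sqr ler_wsqrtr// lerDr sqr_ge0//.
Qed.

Definition re_inv z := complex.Re z^-1.
Definition im_inv z := complex.Im z^-1.

Lemma re_invE z :
  re_inv z = complex.Re z / (complex.Re z ^+ 2 + complex.Im z ^+ 2).
Proof. by case: z. Qed.

Lemma im_invE z :
  im_inv z = - (complex.Im z / (complex.Re z ^+ 2 + complex.Im z ^+ 2)).
Proof. by case: z. Qed.

Lemma measurable_sqr_norm : measurable_fun (setT : set (borelC R))
  (fun z => complex.Re z ^+ 2 + complex.Im z ^+ 2).
Proof.
apply: measurable_funD; apply: measurable_funX.
  exact: measurable_Re.
exact: measurable_Im.
Qed.

Lemma measurable_re_inv : measurable_fun (setT : set (borelC R)) re_inv.
Proof.
rewrite (funext re_invE); apply: measurable_funM; first exact: measurable_Re.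
exact: measurableT_comp measurable_inv measurable_sqr_norm.
Qed.

Lemma measurable_im_inv : measurable_fun (setT : set (borelC R)) im_inv.
Proof.
rewrite (funext im_invE); apply: measurable_funN.
apply: measurable_funM; first exact: measurable_Im.
exact: measurableT_comp measurable_inv measurable_sqr_norm.
Qed.

Lemma modulusE z :
  modulus z = Num.sqrt (complex.Re z ^+ 2 + complex.Im z ^+ 2).
Proof. by case: z. Qed.

Lemma sqr_modulus z :
  modulus z ^+ 2 = complex.Re z ^+ 2 + complex.Im z ^+ 2.
Proof. by rewrite modulusE sqr_sqrtr// addr_ge0 ?sqr_ge0. Qed.

Lemma modulus_ge0 z : 0 <= modulus z.
Proof. by rewrite modulusE sqrtr_ge0. Qed.

Lemma modulus_eq0 z : (modulus z == 0) = (z == 0).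
Proof.
apply/eqP/eqP => [/ComplexField.Normc.eq0_normc//|->].
by rewrite /modulus /= expr0n/= addr0 sqrtr0.
Qed.

Lemma sqr_inv_modulus z : re_inv z ^+ 2 + im_inv z ^+ 2 = (modulus z ^+ 2)^-1.
Proof.
have [->|z0] := eqVneq z 0.
  have -> : modulus 0 = 0 :> R by apply/eqP; rewrite modulus_eq0.
  by rewrite /re_inv /im_inv invr0 /= expr0n/= addr0 invr0.
rewrite re_invE im_invE -sqr_modulus sqrrN !expr_div_n -mulrDl -sqr_modulus.
by field; rewrite modulus_eq0.
Qed.

Lemma measurable_modulus : measurable_fun (setT : set (borelC R)) (@modulus R).
Proof.
rewrite (funext modulusE); apply: (measurableT_comp _ measurable_sqr_norm).
by apply: continuous_measurable_fun; exact: sqrt_continuous.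
Qed.

Lemma lne_sqrt x : 0 <= x -> (lne (Num.sqrt x)%:E = lne x%:E * 2^-1%:E)%E.
Proof.
rewrite le_eqVlt => /predU1P[<-|x0].
  by rewrite sqrtr0 le0_lneNy// gt0_mulNye// lte_fin invr_gt0.
rewrite !lne_EFin ?sqrtr_gt0// -EFinM; congr EFin.
rewrite -[in RHS](sqr_sqrtr (ltW x0)) lnXn ?sqrtr_gt0// -[_ *+ 2]mulr_natl.
by field.
Qed.

Lemma Hker_real_div x z :
  Hker (x%:C%C / z) = cart_Hker (x * re_inv z) (x * im_inv z).
Proof.
have -> : x%:C%C / z = ((x * re_inv z) +i* (x * im_inv z))%C.
  rewrite /re_inv /im_inv; case: (z^-1) => a b.
  by apply/eqP; rewrite eq_complex /= !mul0r subr0 addr0 !eqxx.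
rewrite /Hker modulusE lne_sqrt ?addr_ge0 ?sqr_ge0//.
by rewrite /cart_Hker (_ : complex.Im _ = - (x * im_inv z)) ?sqrrN//= sub0r.
Qed.

Definition genus_integrand z : \bar R :=
  (mine ((modulus z)%:E^-1) (((modulus z) ^+ 2)%:E^-1))%E.

Lemma genus_integrandE z : genus_integrand z =
  if modulus z <= 0 then +oo%E else (genus_weight (re_inv z) (im_inv z))%:E.
Proof.
rewrite /genus_integrand; have [m0|m0] := leP (modulus z) 0.
  have -> : modulus z = 0 by apply/eqP; rewrite eq_le m0 modulus_ge0.
  by rewrite expr0n/= inve0 minxx.
rewrite !inver !gt_eqF ?exprn_gt0// -EFin_min /genus_weight sqr_inv_modulus.
by rewrite -exprVn sqrtr_sqr ger0_norm// invr_ge0 ltW.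
Qed.

Lemma measurable_genus_integrand :
  measurable_fun (setT : set (borelC R)) genus_integrand.
Proof.
rewrite (funext genus_integrandE); apply: measurable_fun_ifT => //.
  by apply: measurable_fun_ler => //; exact: measurable_modulus.
apply/measurable_EFinP; apply: measurable_genus_weight.
  exact: measurable_re_inv.
exact: measurable_im_inv.
Qed.

Lemma genus_weight_le_integrand z :
  ((genus_weight (re_inv z) (im_inv z))%:E <= genus_integrand z)%E.
Proof. by rewrite genus_integrandE; case: ifP; rewrite ?leey. Qed.

Lemma genus_integrand_ge0 z : (0 <= genus_integrand z)%E.
Proof.
by apply: le_trans (genus_weight_le_integrand z); rewrite lee_fin genus_weight_ge0.
Qed.

(** * Consequences of genus one integrability *)

Section measure.
Local Open Scope ereal_scope.
Variable mu : {measure set (borelC R) -> \bar R}.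
Hypothesis mufin : genus_one_integrable mu.

Lemma genus_weight_fin (r : R) : (0 < r)%R ->
  \int[mu]_z (genus_weight (r * re_inv z) (r * im_inv z))%:E < +oo.
Proof.
move=> r0; pose c := (`|r| + r ^+ 2)%R.
have c0 : (0 <= c)%R by rewrite addr_ge0 ?sqr_ge0.
apply: (@le_lt_trans _ _ (\int[mu]_z (c%:E * genus_integrand z))).
  apply: ge0_le_integral => //.
  - by move=> z _; rewrite lee_fin genus_weight_ge0.
  - apply/measurable_EFinP; apply: measurable_genus_weight;
      apply: measurable_funM => //.
      exact: measurable_re_inv.
    exact: measurable_im_inv.
  - by apply: measurable_funeM; exact: measurable_genus_integrand.
  - move=> z _; apply: (@le_trans _ _ (c * genus_weight (re_inv z) (im_inv z))%:E).
      by rewrite lee_fin genus_weight_scale.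
    by rewrite EFinM lee_wpmul2l ?lee_fin// genus_weight_le_integrand.
rewrite ge0_integralZl// ?lte_mul_pinfty//.
- exact: measurable_genus_integrand.
- by move=> z _; exact: genus_integrand_ge0.
Qed.

Lemma measurable_origin : measurable ([set z | modulus z <= 0]%R : set (borelC R)).
Proof.
rewrite -[X in measurable X]setTI.
have h : measurable_fun (setT : set (borelC R)) (fun z => modulus z <= 0)%R.
  by apply: measurable_fun_ler => //; exact: measurable_modulus.
exact: (h measurableT [set true]).
Qed.

(** An integrable function is finite almost everywhere, and [genus_integrand] is +oo at the
    origin. *)
Lemma measure_origin : mu [set z | modulus z <= 0]%R = 0.
Proof.
have : mu.-integrable setT genus_integrand.
  apply/integrableP; split; first exact: measurable_genus_integrand.
  rewrite (_ : integral _ _ _ = \int[mu]_z genus_integrand z); first exact: mufin.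
  by apply: eq_integral => z _; rewrite gee0_abs// genus_integrand_ge0.
move=> /(integrable_ae measurableT)[N [mN N0 sN]].
apply/eqP; rewrite eq_le measure_ge0 andbT -N0.
apply: le_measure; rewrite ?inE//; first exact: measurable_origin.
move=> z /= z0; apply: sN => /= /(_ I).
by rewrite genus_integrandE z0.
Qed.

(** Tonelli's theorem requires this. The sets where the weight is at least 1/(n + 1) have finite
    measure by Markov's inequality and exhaust the plane except for the origin, a null set adjoined
    to each of them. *)
Lemma genus_sigma_finite : sigma_finite setT mu.
Proof.
have mw : measurable_fun (setT : set (borelC R))
    (fun z => genus_weight (re_inv z) (im_inv z)).
  apply: measurable_genus_weight.
    exact: measurable_re_inv.
  exact: measurable_im_inv.
have mF n : measurable
    ([set z | n.+1%:R^-1 <= genus_weight (re_inv z) (im_inv z)]%R : set (borelC R)).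
  rewrite -[X in measurable X]setTI.
  have h : measurable_fun (setT : set (borelC R))
      (fun z => n.+1%:R^-1 <= genus_weight (re_inv z) (im_inv z))%R.
    exact: measurable_fun_ler.
  exact: (h measurableT [set true]).
exists (fun n => [set z | modulus z <= 0]%R `|`
    [set z | n.+1%:R^-1 <= genus_weight (re_inv z) (im_inv z)]%R).
  apply/esym; rewrite -subTset => z _.
  have [z0|z0] := leP (modulus z) 0%R; first by exists 0%N => //; left.
  have w0 : (0 < genus_weight (re_inv z) (im_inv z))%R.
    by rewrite lt_min sqrtr_gt0 sqr_inv_modulus invr_gt0 exprn_gt0.
  pose n := Num.truncn (genus_weight (re_inv z) (im_inv z))^-1%R.
  exists n => //; right => /=.
  rewrite -[leRHS]invrK lef_pV2 ?posrE ?invr_gt0//.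
  by apply: ltW; rewrite /n truncnS_gt.
move=> n; split; first by apply: measurableU => //; exact: measurable_origin.
apply: (@le_lt_trans _ _ (0 + mu
    [set z | n.+1%:R^-1 <= genus_weight (re_inv z) (im_inv z)]%R)).
  by rewrite -measure_origin; apply: measureU2 => //; exact: measurable_origin.
rewrite add0e.
have n0 : (0 < n.+1%:R^-1 :> R)%R by rewrite invr_gt0.
suff : mu [set z | n.+1%:R^-1 <= genus_weight (re_inv z) (im_inv z)]%R *
   (n.+1%:R^-1 : R)%:E < +oo.
  rewrite -[X in _ < X -> _](@gt0_mulye _ (n.+1%:R^-1 : R)%:E)//.
  by rewrite lte_pmul2r// lte_fin.
rewrite -integral_if_cst ?(ltW n0)//.
apply: le_lt_trans (genus_weight_fin ltr01).
apply: ge0_le_integral => //.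
- by move=> z _; rewrite lee_fin; case: ifP => // _; exact: ltW.
- apply/measurable_EFinP; apply: measurable_fun_ifT => //.
  exact: measurable_fun_ler.
- by apply/measurable_EFinP; do 2 under eq_fun do rewrite mul1r.
- move=> z _; rewrite lee_fin !mul1r; case: ifP => // _; exact: genus_weight_ge0.
Qed.

(** Away from the origin, |zeta| <= r means |r / zeta| >= 1. The origin, where both inverse
    coordinates are 0 by convention, falls outside the right-hand set but is null. *)
Lemma counting_function_outer (r : R) : (0 < r)%R ->
  counting_function mu r <=
  mu [set z | 1 <= (r * re_inv z) ^+ 2 + (r * im_inv z) ^+ 2]%R.
Proof.
move=> r0; set A := [set z | 1 <= _]%R.
have mA : measurable (A : set (borelC R)).
  rewrite -[X in measurable X]setTI.
  have h : measurable_fun (setT : set (borelC R))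
      (fun z => 1 <= (r * re_inv z) ^+ 2 + (r * im_inv z) ^+ 2)%R.
    apply: measurable_fun_ler => //.
    apply: measurable_funD; apply: measurable_funX; apply: measurable_funM => //.
      exact: measurable_re_inv.
    exact: measurable_im_inv.
  exact: (h measurableT [set true]).
have mO := measurable_origin.
have mC : measurable ([set z | modulus z <= r]%R : set (borelC R)).
  rewrite -[X in measurable X]setTI.
  have h : measurable_fun (setT : set (borelC R)) (fun z => modulus z <= r)%R.
    by apply: measurable_fun_ler => //; exact: measurable_modulus.
  exact: (h measurableT [set true]).
rewrite -[leRHS]add0e -measure_origin; apply: le_trans (measureU2 mu mO mA).
apply: le_measure; rewrite ?inE//; first exact: measurableU.
move=> z /= zr; have [z0|z0] := leP (modulus z) 0%R; [by left|right].
rewrite /A/= !exprMn -mulrDr sqr_inv_modulus.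
by rewrite ler_pdivlMr ?exprn_gt0// mul1r lerXn2r// nnegrE ?modulus_ge0 ?ltW.
Qed.

End measure.

End borel_complex.

Theorem corollary1 (R : realType) :
  exists K : R, 0 < K /\
    forall mu : {measure set (borelC R) -> \bar R},
      locally_finite_measure mu ->
      genus_one_integrable mu ->
      (forall z : R[i], (0 <= canonical_integral mu z)%E) ->
      forall r : R, 0 < r ->
        (counting_function mu r <=
         K%:E *
         (r%:E *
            \int[lebesgue_measure]_(t in `]0%R, r]) (levin_tsuji mu t * (t ^- 2)%:E)
          + (r ^+ 2)%:E *
            \int[lebesgue_measure]_(t in `[r, +oo[)
              (levin_tsuji mu t * (t ^- 3)%:E)))%E.
Proof.
have [k k0 kP] := @integral_log_dom_le_imag R.
(* The factor [10 * k] comes from [measure_outer_le_imag], and 32 from the layer cake estimate. *)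
exists (10 * k * 32); split; first by rewrite !mulr_gt0.
move=> mu _ mufin pot r r0.
pose nu := sigma_finite_of (genus_sigma_finite mufin) :
  {sigma_finite_measure set (borelC R) -> \bar R}.
apply: (le_trans (counting_function_outer mufin r0)).
have mre : measurable_fun (setT : set (borelC R)) (fun z => r * re_inv z).
  by apply: measurable_funM => //; exact: measurable_re_inv.
have mim : measurable_fun (setT : set (borelC R)) (fun z => r * im_inv z).
  by apply: measurable_funM => //; exact: measurable_im_inv.
(* The abstract potential with coordinates scaled by [r] is u at the real point [x * r]. *)
have pot0 x :
    (0 <= \int[mu]_z cart_Hker (x * (r * re_inv z)) (x * (r * im_inv z)))%E.
  have := pot (x * r)%:C%C; rewrite /canonical_integral.
  by under eq_integral do rewrite Hker_real_div -!mulrA.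
have := measure_outer_le_imag (mu := nu) mre mim (genus_weight_fin mufin r0)
  pot0 k0 kP.
move=> /le_trans; apply.
rewrite [(10 * k * 32)%:E]EFinM -muleA lee_wpmul2l//.
  by rewrite lee_fin mulr_ge0// ltW.
exact: (integral_imag_le_level nu measurable_im_inv r0).
Qed.
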